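(* Let $K=\sum_{n\ge0}\kappa_n\otimes(e_n\otimes e_n^* )$, an $\mathcal{L}(\ell^2)$-valued kernel on the Cantor group $G$. The operator $f\mapsto \mathrm{P.V.}(K*f)$ coincides, for $f\in L^2(G,\ell^2)$, with the orthogonal projection $P:L^2(G,\ell^2)\to\iota(H^2(\delta))$, and for $f\in L^1(G,\ell^2)$ the principal value exists almost everywhere and defines a bounded operator $L^1(G,\ell^2)\to L^{1,\infty}(G,\ell^2)$ (hence a bounded operator $L^p(G,\ell^2)\to L^p(G,\ell^2)$ for every $1<p<\infty$).
   Context: $G=\mathbb{Z}_2^{\mathbb{N}^+}$ (elements $x=(x_1,x_2,\dots)$, $x_k\in\{0,1\}$, identified with subsets of $\mathbb{N}^+$, $\emptyset$ the identity), with Haar probability measure $\mu$, coordinatewise addition mod 2, and metric $d(x,y)=2^{-\min\{k:x_k\ne y_k\}}$ (with $\min\emptyset=\infty$); $\min x=\min\{k:x_k=1\}$. For finite $A\subset\mathbb{N}^+$, $w_A(x)=(-1)^{\sum_{k\in A}x_k}$, with $\max\emptyset=0$. $\mathcal{F}_n$ is the $\sigma$-algebra generated by $x_1,\dots,x_n$, $\mathbb{E}_n$ its conditional expectation, $\Delta_0=\mathbb{E}_0$, $\Delta_n=\mathbb{E}_n-\mathbb{E}_{n-1}$ ($n\ge1$); $\Delta_nf=\sum_{\max A=n}\langle f,w_A\rangle w_A$. Set $\kappa_n=\sum_{\max A=n}w_A$; explicitly $\kappa_0\equiv1$ and for $n\ge1$: $\kappa_n(x)=2^{n-1}$ if $n<\min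 x$, $-2^{n-1}$ if $n=\min x$, $0$ if $n>\min x$, so $\Delta_n f=\kappa_n*f$. $(e_n)_{n\ge0}$ is the unit vector basis of $\ell^2$ and $e_n^*$ the $n$-th coordinate functional. Convolution: $(K*f)(x)=\int_G K(y)f(x-y)\,d\mu(y)$, and $\mathrm{P.V.}(K*f)(x)=\lim_{r\to0}\int_{G\setminus B(\emptyset,r)}K(y)f(x-y)\,d\mu(y)$. $\iota(H^2(\delta))=\{(f_n)_{n\ge0}\in L^2(G,\ell^2):\Delta_nf_n=f_n\ \forall n\}$ (the $L^2(\ell^2)$-closed span of $w_A\otimes e_{\max A}$). $L^{1,\infty}(G,\ell^2)$ is weak $L^1$ with quasinorm $\sup_{\lambda>0}\lambda\mu\{\|g\|_{\ell^2}>\lambda\}$. *)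

(* Defs.v *)
From HB Require Import structures.
From mathcomp Require Import all_boot all_order all_algebra.
From mathcomp Require Import all_classical all_reals all_analysis.
Set Implicit Arguments. Unset Strict Implicit. Unset Printing Implicit Defensive.
Import Order.TTheory GRing.Theory Num.Theory.
Import numFieldNormedType.Exports.
Local Open Scope classical_set_scope.
Local Open Scope ring_scope.

(* The Cantor group G = Z_2^{N^+}.  An element is x : nat -> bool where the
   paper's coordinate x_k (k >= 1) is  x (k - 1)  (0-based storage). *)
Definition Gset := nat -> bool.

Definition cylinders : set (set Gset) :=
  [set A | exists (i : nat) (b : bool), A = [set x | x i = b]].

(* G as a measurable space (Borel sigma-algebra = sigma-algebra generated by
   the cylinders). *)
Definition G : Type := g_sigma_algebraType cylinders.
Definition Gdisp := cylinders.-sigma%mdisp.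

(* group law (coordinatewise addition mod 2); note x - y = x + y *)
Definition addG (x y : G) : G := fun k => xorb (x k) (y k).
Definition emptyG : G := fun _ => false.

(* min x = min {k >= 1 : x_k = 1} (None encodes min emptyset = infinity) *)
Definition minG (x : G) : option nat :=
  match pselect (exists i, x i) with
  | left H => Some (@ex_minn (fun i => x i) H).+1
  | right _ => None
  end.

Section WithR.
Variable R : realType.

Definition dG (x y : G) : R :=
  match minG (addG x y) with
  | Some m => (2 ^+ m)^-1
  | None => 0
  end.

Definition ballG (c : G) (r : R) : set G := [set y | dG c y < r].

Definition kappa (n : nat) (x : G) : R :=
  match n with
  | 0 => 1
  | n'.+1 =>
      match minG x with
      | None => 2 ^+ n'
      | Some m => if (n < m)%N then 2 ^+ n'
                  else if n == m then - 2 ^+ n' else 0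
      end
  end.

Definition l2sq (v : nat -> R) : \bar R :=
  (\sum_(0 <= n <oo) ((v n) ^+ 2)%:E)%E.

Definition is_l2 (v : nat -> R) : Prop := (l2sq v < +oo)%E.

Definition normV (v : nat -> R) : \bar R :=
  match l2sq v with
  | r%:E => (Num.sqrt r)%:E
  | _ => +oo%E
  end.

Variable mu : {measure set G -> \bar R}.

(* (strong = weak, l^2 being separable) measurability of f : G -> l^2 *)
Definition measV (f : G -> nat -> R) : Prop :=
  forall n, measurable_fun setT (fun x => f x n).

Definition LpnormV (p : R) (f : G -> nat -> R) : \bar R :=
  ((\int[mu]_x (normV (f x) `^ p)) `^ p^-1)%E.

Definition LpV (p : R) (f : G -> nat -> R) : Prop :=
  measV f /\ (LpnormV p f < +oo)%E.

Definition innerV (f g : G -> nat -> R) : \bar R :=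
  (\int[mu]_x (\sum_(0 <= n <oo) ((f x n) * (g x n))%:E))%E.

Definition convG (k h : G -> R) (x : G) : R :=
  fine (\int[mu]_y ((k y) * h (addG x y))%:E)%E.

(* iota(H^2(delta)) = {(f_n) in L^2(G,l^2) : Delta_n f_n = f_n for all n},
   with Delta_n h = kappa_n * h *)
Definition H2delta : set (G -> nat -> R) :=
  [set g | LpV 2 g /\
           forall n, {ae mu, forall x, convG (kappa n) (fun y => g y n) x = g x n}].

(* truncated integral  int_{G \ B(emptyset, r)} K(y) f(x - y) dmu(y),
   computed componentwise: (K(y) v)_n = kappa_n(y) v_n *)
Definition truncK (f : G -> nat -> R) (x : G) (r : R) : nat -> R :=
  fun n => fine (\int[mu]_(y in ~` ballG emptyG r)
                   ((kappa n y) * f (addG x y) n)%:E)%E.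

Definition PVlim (f : G -> nat -> R) (x : G) (v : nat -> R) : Prop :=
  is_l2 v /\
  ((fun r => l2sq (fun n => truncK f x r n - v n)) @ 0^'+ --> 0%E).

Definition PVexists (f : G -> nat -> R) (x : G) : Prop := exists v, PVlim f x v.

(* P.V.(K * f)(x), set to 0 where the principal value does not exist *)
Definition PVK (f : G -> nat -> R) (x : G) : nat -> R :=
  match pselect (PVexists f x) with
  | left H => projT1 (cid H)
  | right _ => fun _ => 0
  end.

Definition weakL1V (g : G -> nat -> R) : \bar R :=
  ereal_sup [set (lam%:E * mu [set x | (lam%:E < normV (g x))%E])%E
            | lam in [set lam : R | 0 < lam]].

End WithR.

(* Main.v *)
(** Write [E_n] for the average over the [n]-th dyadic cylinder.  The truncated
    integral at scale [2^-N] has [n]-th coordinate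
    [Delta_n f_n - w_n 2^-N E_N f_n] for [n <= N] and [0] for [n > N], with
    [w_0 = 1], [w_n = 2^(n-1)], so the principal value can only be
    [T f = (Delta_n f_n)_n].

    [|T f|] is dominated pointwise by the square function [S] of the
    [l^2]-valued dyadic martingale [E_n f].  A function [U] with
    [U(v+d, y+|d|^2) + U(v-d, y+|d|^2) <= 2 U(v, y)] makes
    [U(E_n f, S_n^2)] a supermartingale; the choice
    [U = y - |v|^2] where [|v| + sqrt y < l], [U = l^2 - 2 l |v|] elsewhere,
    gives the weak type (1,1), and [U = y^q - q y^(q-1) |v|^2] gives [L^(2q)] for
    [q >= 1].  The range [1 < p < 2] follows by duality, [T] being self-adjoint.

    The error terms [w_n 2^-N E_N f_n] tend to [0] in [l^2] almost everywhere:
    finitely many coordinates do so everywhere, because the integral over a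
    shrinking cylinder tends to [0], and the remaining ones are controlled by
    the maximal inequality for the tail of [f], whose [L^1] norm tends to [0]. *)
Require Import Defs.
From HB Require Import structures.
From mathcomp Require Import all_boot all_order all_algebra.
From mathcomp Require Import all_classical all_reals all_analysis.
From mathcomp Require Import measurable_realfun ring lra.
Import Order.TTheory GRing.Theory Num.Theory.
Import numFieldNormedType.Exports.
Set Implicit Arguments.
Unset Strict Implicit.
Unset Printing Implicit Defensive.
Local Open Scope classical_set_scope.
Local Open Scope ring_scope.

(** Coordinate flips replace conditional expectation. A point and its flip in coordinate [n]
    represent the two halves of a level-[n] cylinder, so the next martingale increment is [d] on one
    half and [-d] on the other. The square function sees only |d|^2, so its next value is the same
    on both halves; this predictability is why both terms of the inequality for U carry y+|d|^2. The
    power U needs y^(q-1) to be nondecreasing, hence [q >= 1], and this forces the detour through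
    duality for [p < 2]. Estimates are proved first for finitely many coordinates and levels, with
    constants independent of their number. There everything built from averages takes finitely many
    values, so measurability and integrability come for free and integrals of powers of |T f| are
    finite and can be absorbed. The full l^2 norm appears only through monotone limits. *)

(** * Cylinders, flips and functions of finitely many coordinates *)

Definition cyl (n : nat) (x : G) : set G :=
  [set y | forall i, (i < n)%N -> y i = x i].

Definition unitG (n : nat) : G := fun k => k == n.

Definition flip (n : nat) (x : G) : G := addG (unitG n) x.

(** For real functions this is F_n-measurability in pointwise form: F_n is finite and its atoms are
    the level-[n] cylinders. *)
Definition adapted {T : Type} (n : nat) (phi : G -> T) :=
  forall x y, cyl n x y -> phi y = phi x.

Lemma addGK (a : G) : involutive (addG a).
Proof. by move=> x; apply/funext => k; rewrite /addG; case: (a k); case: (x k). Qed.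

Lemma add0G (a : G) : addG emptyG a = a.
Proof. by apply/funext => k; rewrite /addG /emptyG; case: (a k). Qed.

Lemma flip_at n x : flip n x n = ~~ x n.
Proof. by rewrite /flip /addG /unitG eqxx; case: (x n). Qed.

Lemma flip_neq n i x : i != n -> flip n x i = x i.
Proof. by rewrite /flip /addG /unitG => /negbTE ->; case: (x i). Qed.

Lemma cylS n x : cyl n.+1 x = cyl n x `&` [set y | y n = x n].
Proof.
apply/seteqP; split => [y h|y [h1 /= h2] i].
  by split => [i /ltnW|]; apply: h.
by rewrite ltnS leq_eqVlt => /orP[/eqP ->//|]; exact: h1.
Qed.

Lemma cyl0 x : cyl 0 x = setT.
Proof. by apply/seteqP; split. Qed.

Lemma cyl_eq n x y : cyl n x y -> cyl n y = cyl n x.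
Proof.
by move=> xy; apply/seteqP; split => z h i ltin; rewrite h// xy.
Qed.

Lemma cyl_sub m n x : (m <= n)%N -> cyl n x `<=` cyl m x.
Proof. by move=> mn y h i im; apply: h; apply: leq_trans mn. Qed.

Lemma cyl_flip n m x : (n <= m)%N -> cyl n x (flip m x).
Proof. by move=> nm i ltin; rewrite flip_neq// ltn_eqF// (leq_trans ltin). Qed.

Lemma cyl_split n x : cyl n x = cyl n.+1 x `|` cyl n.+1 (flip n x).
Proof.
apply/seteqP; split => [y h|y [|]].
- rewrite !cylS (cyl_eq (cyl_flip x (leqnn n))) -setIUr; split => //=.
  by rewrite flip_at; case: (y n); case: (x n); auto.
- exact: cyl_sub.
- by move/(cyl_sub (leqnSn n)); rewrite (cyl_eq (cyl_flip x (leqnn n))).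
Qed.

Lemma cyl_disj n x : [disjoint cyl n.+1 x & cyl n.+1 (flip n x)].
Proof.
apply/disj_setPS => y [] /(_ n (ltnSn n)) h1 /(_ n (ltnSn n)).
by rewrite flip_at h1; case: (x n).
Qed.

Lemma adapted_flip T n m (phi : G -> T) x :
  adapted n phi -> (n <= m)%N -> phi (flip m x) = phi x.
Proof. by move=> h nm; apply: h; exact: cyl_flip. Qed.

Lemma adaptedW T m n (phi : G -> T) : (m <= n)%N ->
  adapted m phi -> adapted n phi.
Proof. by move=> mn h x y /(cyl_sub mn); exact: h. Qed.

Lemma adapted0 T (phi : G -> T) : adapted 0 phi -> phi = cst (phi emptyG).
Proof. by move=> h; apply/funext => x; apply: h; rewrite cyl0. Qed.

(** Freezing coordinate [n] lowers the level of an adapted function by one, which drives the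
    inductions for measurability and boundedness. *)
Definition setG n b (x : G) : G := fun k => if k == n then b else x k.

Lemma adapted_setG T n b (phi : G -> T) :
  adapted n.+1 phi -> adapted n (phi \o setG n b).
Proof.
move=> h x y xy; apply: h => i; rewrite ltnS leq_eqVlt /setG.
by case: eqVneq => //= _; exact: xy.
Qed.

Lemma setGE T n (phi : G -> T) :
  phi = fun x => if x n then phi (setG n true x) else phi (setG n false x).
Proof.
apply/funext => x; have -> : phi x = phi (setG n (x n) x); last by case: (x n).
by congr phi; apply/funext => k; rewrite /setG; case: eqVneq => [->|].
Qed.

Lemma measurable_coord n b : measurable [set x : G | x n = b].
Proof. by apply: sub_sigma_algebra; exists n, b. Qed.

Lemma measurable_cyl n x : measurable (cyl n x).
Proof.
elim: n => [|n ih]; first by rewrite cyl0.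
by rewrite cylS; apply: measurableI => //; exact: measurable_coord.
Qed.
#[local] Hint Resolve measurable_cyl : core.

Lemma measurable_addG a : measurable_fun [set: G] (addG a).
Proof.
apply: (@measurability _ _ G G setT (addG a) cylinders) => // _ [_ [i [b ->] <-]].
rewrite setTI (_ : _ @^-1` _ = [set x : G | x i = xorb (a i) b]).
  exact: measurable_coord.
apply/seteqP; rewrite /addG; split => x /=.
  by move=> <-; case: (a i); case: (x i).
by move=> ->; case: (a i); case: b.
Qed.

Lemma adapted_measurable d (T : measurableType d) n (phi : G -> T) :
  adapted n phi -> measurable_fun setT phi.
Proof.
elim: n phi => [|n ih] phi h; first by rewrite (adapted0 h).
rewrite (setGE n phi); apply: measurable_fun_ifT.
- apply: (measurable_fun_bool true); rewrite setTI.
  exact: measurable_coord.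
- exact: (ih _ (adapted_setG true h)).
- exact: (ih _ (adapted_setG false h)).
Qed.

Lemma adapted_measurable_set n (P : G -> bool) :
  adapted n P -> measurable [set x | P x].
Proof.
move=> aP; have := adapted_measurable aP measurableT (Y := [set true]).
by rewrite setTI; apply.
Qed.

Lemma adapted_bounded (R : realType) n (phi : G -> R) : adapted n phi ->
  exists2 M, 0 <= M & forall x, `|phi x| <= M.
Proof.
elim: n phi => [|n ih] phi h.
  by exists `|phi emptyG| => // x; rewrite (adapted0 h).
have [M1 M10 h1] := ih _ (adapted_setG true h).
have [M2 M20 h2] := ih _ (adapted_setG false h).
exists (M1 + M2) => [|x]; first exact: addr_ge0.
rewrite (setGE n phi); case: ifP => _.
  by rewrite (le_trans (h1 x))// lerDl.
by rewrite (le_trans (h2 x))// lerDr.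
Qed.

(** * Finite-dimensional norms and the two Bellman functions *)

Section vectors.
Variable R : realType.
Implicit Types (s : seq nat) (u v d : nat -> R) (y l q : R).

Definition sqn s v : R := \sum_(k <- s) v k ^+ 2.

Definition nrm s v : R := Num.sqrt (sqn s v).

Lemma sqn_ge0 s v : 0 <= sqn s v.
Proof. by apply: sumr_ge0 => k _; exact: sqr_ge0. Qed.
#[local] Hint Resolve sqn_ge0 : core.

Lemma nrm_ge0 s v : 0 <= nrm s v.
Proof. exact: sqrtr_ge0. Qed.
#[local] Hint Resolve nrm_ge0 : core.

Lemma nrm_sqr s v : nrm s v ^+ 2 = sqn s v.
Proof. by rewrite sqr_sqrtr. Qed.

Lemma nrm_powR s v p : nrm s v `^ p = sqn s v `^ (p / 2).
Proof. by rewrite /nrm -powR12_sqrt// -powRrM mulrC. Qed.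

Lemma parallelogram s u d : sqn s (fun k => u k + d k) +
  sqn s (fun k => u k - d k) = 2 * (sqn s u + sqn s d).
Proof.
rewrite /sqn -!big_split /= mulr_sumr; apply: eq_bigr => k _; ring.
Qed.

Lemma le_of_sqr (a b : R) : 0 <= b -> a ^+ 2 <= b ^+ 2 -> a <= b.
Proof. by move=> b0 ab; rewrite leNgt; apply/negP => h; nra. Qed.

Lemma sqr_le_of_sqrt (a b : R) : 0 <= a -> 0 <= b ->
  a <= Num.sqrt b -> a ^+ 2 <= b.
Proof. by move=> a0 b0 ab; have := sqr_sqrtr b0; nra. Qed.

Lemma dot_le_nrm s u v : \sum_(k <- s) u k * v k <= nrm s u * nrm s v.
Proof.
apply: le_of_sqr; first exact: mulr_ge0.
rewrite exprMn !nrm_sqr /sqn.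
elim: s => [|k s ih]; first by rewrite !big_nil expr0n mul0r.
rewrite !big_cons; move: ih; have := sqn_ge0 s u; have := sqn_ge0 s v.
rewrite /sqn.
set a := \sum_(_ <- _) _ * _; set b := \sum_(_ <- _) _; set c := \sum_(_ <- _) _.
move: (u k) (v k) => x y b0 c0 h.
(* Only the cross terms remain. After squaring, the induction hypothesis [a ^+ 2 <= c * b] reduces
   them to the arithmetic-geometric mean inequality for [x ^+ 2 * b] and [y ^+ 2 * c]. *)
suff : 2 * (x * y * a) <= x ^+ 2 * b + y ^+ 2 * c by nra.
apply: le_of_sqr; first by rewrite addr_ge0// mulr_ge0// sqr_ge0.
have : (x ^+ 2 * y ^+ 2) * a ^+ 2 <= (x ^+ 2 * y ^+ 2) * (c * b).
  by rewrite ler_wpM2l// mulr_ge0// sqr_ge0.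
have := sqr_ge0 (x ^+ 2 * b - y ^+ 2 * c).
rewrite !expr2; lra.
Qed.

Lemma nrmD s u d : nrm s (fun k => u k + d k) <= nrm s u + nrm s d.
Proof.
rewrite -[leRHS]ger0_norm ?addr_ge0// -sqrtr_sqr ler_sqrt ?sqr_ge0//.
have -> : sqn s (fun k => u k + d k) =
    sqn s u + 2 * (\sum_(k <- s) u k * d k) + sqn s d.
  rewrite /sqn mulr_sumr -!big_split /=; apply: eq_bigr => k _; ring.
by rewrite sqrrD !nrm_sqr; have := dot_le_nrm s u d; lra.
Qed.

Lemma nrmN s d : nrm s (fun k => - d k) = nrm s d.
Proof. by rewrite /nrm /sqn; under eq_bigr do rewrite sqrrN. Qed.

Lemma nrmB s u d : nrm s (fun k => u k - d k) <= nrm s u + nrm s d.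
Proof. by rewrite -(nrmN s d); exact: nrmD. Qed.

(** Midpoint convexity: it settles the outer branch of [weakU] and makes the norms of the averages a
    submartingale. *)
Lemma nrm_mid s u d :
  2 * nrm s u <= nrm s (fun k => u k + d k) + nrm s (fun k => u k - d k).
Proof.
apply: le_trans (nrmD _ _ _); rewrite -[2]ger0_norm// -sqrtr_sqr -sqrtrM ?sqr_ge0//.
rewrite ler_sqrt// /sqn mulr_sumr; apply: ler_sum => k _.
by rewrite (_ : u k + d k + (u k - d k) = 2 * u k) ?exprMn//; ring.
Qed.

Lemma nrm_le_sum s v : nrm s v <= \sum_(k <- s) `|v k|.
Proof.
elim: s => [|k s ih]; first by rewrite /nrm /sqn !big_nil sqrtr0.
have := sqn_ge0 s v; have := ih; rewrite /nrm /sqn !big_cons.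
set a := \sum_(_ <- _) _; set b := \sum_(_ <- _) _ => ab b0.
have a0 : 0 <= b by apply: le_trans ab; exact: sqrtr_ge0.
rewrite -[leRHS]ger0_norm ?addr_ge0// -sqrtr_sqr ler_sqrt ?sqr_ge0//.
rewrite -[v k ^+ 2](real_normK (num_real _)).
have := sqr_sqrtr b0; move: ab (sqrtr_ge0 a) (normr_ge0 (v k)); nra.
Qed.

Lemma powR_tangent q (a b : R) : 1 <= q -> 0 <= a -> 0 <= b ->
  b `^ q + q * b `^ (q - 1) * (a - b) <= a `^ q.
Proof.
rewrite le_eqVlt => /predU1P[<-|q1] a0 b0.
  by rewrite subrr powRr0 !mul1r !powRr1// addrC subrK.
have q0 : 0 < q by rewrite (lt_trans ltr01).
have q10 : 0 < q - 1 by rewrite subr_gt0.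
have := @conjugate_powR _ a (b `^ (q - 1)) q (q / (q - 1)) a0 (powR_ge0 _ _) q0 _ _.
have qd : 0 < q / (q - 1) by rewrite divr_gt0.
have qc : q^-1 + (q / (q - 1))^-1 = 1.
  by rewrite invfM invrK -{1}[q^-1]mulr1 -mulrDr addrC subrK mulVf ?gt_eqF.
move=> /(_ qd qc); rewrite -powRrM (_ : (q - 1) * (q / (q - 1)) = q); last first.
  by rewrite mulrCA mulfV ?mulr1// gt_eqF.
rewrite -(ler_pM2l q0) mulrDr (_ : q * (a `^ q / q) = a `^ q); last first.
  by rewrite mulrCA mulfV ?mulr1// gt_eqF.
rewrite (_ : q * (b `^ q / (q / (q - 1))) = (q - 1) * b `^ q); last first.
  by rewrite invfM invrK mulrCA !mulrA mulfK ?gt_eqF// mulrC.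
by rewrite mulrBr -!mulrA [b `^ _ * b]mulrC mulr_powRB1//; lra.
Qed.

(* The analogue of Burkholder's function for the weak type (1,1) inequality. *)
Definition weakU s l v y : R :=
  if (nrm s v < l) && (y < (l - nrm s v) ^+ 2) then y - sqn s v
  else l ^+ 2 - 2 * l * nrm s v.

(** The two formulas agree where [y = (l - nrm s v) ^+ 2], and the inner region lies below that
    value of [y]. *)
Lemma weakU_le s l v y : weakU s l v y <= l ^+ 2 - 2 * l * nrm s v.
Proof.
rewrite /weakU; case: ifPn => // /andP[_ h]; rewrite -nrm_sqr.
by move: h; rewrite sqrrB; lra.
Qed.

Lemma weakU_supermartingale s l v d y : 0 < l -> 0 <= y ->
  (weakU s l (fun k => (v k + d k)%R) (y + sqn s d) +
   weakU s l (fun k => v k - d k) (y + sqn s d)) / 2 <= weakU s l v y.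
Proof.
move=> l0 y0; rewrite {3}/weakU; case: ifPn => [/andP[vl yv]|_]; last first.
  have := weakU_le s l (fun k => v k + d k) (y + sqn s d).
  have := weakU_le s l (fun k => v k - d k) (y + sqn s d).
  have := nrm_mid s v d; nra.
(* The inner formula bounds U at both neighbours even if they leave the inner region: if
   [l <= nrm s w], then [nrm s w - l] is at most [nrm s d], because [nrm s v < l]. The parallelogram
   law then averages the inner formula exactly to its value at [v], [y]. *)
have key w : nrm s w <= nrm s v + nrm s d ->
    weakU s l w (y + sqn s d) <= y + sqn s d - sqn s w.
  move=> wvd; rewrite /weakU; case: ifPn => //; rewrite negb_and -!leNgt.
  rewrite -!nrm_sqr => h.
  suff : (l - nrm s w) ^+ 2 <= y + nrm s d ^+ 2 by rewrite sqrrB; lra.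
  by case/orP : h => // h; have := nrm_ge0 s d; nra.
have := key _ (nrmD s v d); have := key _ (nrmB s v d).
have := parallelogram s v d; lra.
Qed.

Lemma weakU_init s l v : 0 < l -> weakU s l v (sqn s v) <= 0.
Proof.
move=> l0; rewrite /weakU subrr; case: ifPn => //; rewrite negb_and -!leNgt.
by rewrite -nrm_sqr; have := nrm_ge0 s v => h0 /orP[h|h]; nra.
Qed.

(** If [l ^+ 2 <= y] the point is in the outer region, where the bound is an equality; in the inner
    region [nrm s v < l] gives |v|^2 <= 2 l |v|. *)
Lemma weakU_final s l v y : 0 < l -> 0 <= y ->
  (if l ^+ 2 <= y then l ^+ 2 else 0) - 2 * l * nrm s v <= weakU s l v y.
Proof.
move=> l0 y0; rewrite /weakU; have := nrm_ge0 s v; have := nrm_sqr s v.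
case: (boolP (_ && _)) => [/andP[vl yv] e v0|_ _ v0]; last first.
  by rewrite lerD2r; case: ifP => // _; exact: sqr_ge0.
rewrite ifF; first by nra.
apply/negbTE; rewrite -ltNge; nra.
Qed.

Definition powU s q v y : R := y `^ q - q * y `^ (q - 1) * sqn s v.

(** By the parallelogram law |v+d|^2 and |v-d|^2 average to |v|^2 + |d|^2. The tangent of the [q]-th
    power at y+|d|^2 absorbs the |d|^2 part, and monotonicity of the power [q - 1] the |v|^2
    part. *)
Lemma powU_supermartingale s q v d y : 1 <= q -> 0 <= y ->
  (powU s q (fun k => (v k + d k)%R) (y + sqn s d) +
   powU s q (fun k => v k - d k) (y + sqn s d)) / 2 <= powU s q v y.
Proof.
move=> q1 y0; rewrite /powU.
have z0 := sqn_ge0 s v; have d0 := sqn_ge0 s d.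
have := parallelogram s v d.
move: (sqn s (fun k => v k + d k)) (sqn s (fun k => v k - d k)) => A B hAB.
have yd : 0 <= y + sqn s d by rewrite addr_ge0.
have tg := powR_tangent q1 y0 yd.
have mono : y `^ (q - 1) <= (y + sqn s d) `^ (q - 1).
  by apply: ge0_ler_powR; rewrite ?nnegrE ?subr_ge0 ?lerDl.
have : q * sqn s v * y `^ (q - 1) <= q * sqn s v * (y + sqn s d) `^ (q - 1).
  by rewrite ler_wpM2l// mulr_ge0//; lra.
move: tg; move: (_ `^ (q - 1)) (_ `^ q) (_ `^ (q - 1)) (_ `^ q) => a b a' b'.
move: (sqn s v) (sqn s d) hAB => z e hAB tg h.
have -> : B = 2 * (z + e) - A by lra.
lra.
Qed.

Lemma powU_init s q v : 1 <= q -> powU s q v (sqn s v) <= 0.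
Proof.
move=> q1; rewrite /powU -mulrA [_ * sqn s v]mulrC mulr_powRB1//; last by lra.
by have := powR_ge0 (sqn s v) q; nra.
Qed.

Lemma powU_final s q v y : 1 <= q -> 0 <= y ->
  y `^ q / 2 - q * (2 * q) `^ (q - 1) * sqn s v `^ q <= powU s q v y.
Proof.
move=> q1 y0; rewrite /powU; have z0 := sqn_ge0 s v; have q0 : 0 < q by lra.
have := powR_ge0 y (q - 1); have := mulr_powRB1 y0 q0; have := mulr_powRB1 z0 q0.
have := powR_ge0 (sqn s v) (q - 1).
have [h|h] := leP (2 * q * sqn s v) y.
  have : 0 <= q * (2 * q) `^ (q - 1) * sqn s v `^ q.
    by rewrite !mulr_ge0 ?powR_ge0//; lra.
  nra.
have : y `^ (q - 1) <= (2 * q) `^ (q - 1) * sqn s v `^ (q - 1).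
  rewrite -powRM//; last by lra.
  by apply: ge0_ler_powR; rewrite ?nnegrE ?subr_ge0 ?mulr_ge0//; lra.
have := powR_ge0 y q.
move: (_ `^ _) (_ `^ _) (_ `^ _) (_ `^ _) (_ `^ _) => a b c e f a0 h1 e0 h2 h3 c0.
have : q * sqn s v * e <= q * sqn s v * (c * b).
  by rewrite ler_wpM2l// mulr_ge0//; lra.
rewrite -h2; lra.
Qed.

End vectors.
#[local] Hint Extern 0 (is_true (0 <= sqn _ _)) => exact: sqn_ge0 : core.
#[local] Hint Extern 0 (is_true (0 <= nrm _ _)) => exact: nrm_ge0 : core.

(** * The l^2 norm as a limit of finite sums *)

Section l2.
Variable R : realType.
Implicit Types (u v : nat -> R).

Lemma ge0_cvge0P (u : nat -> \bar R) : (forall n, 0 <= u n)%E ->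
  u @ \oo --> 0%E <->
  (forall e : R, 0 < e -> exists N, forall n, (N <= n)%N -> (u n <= e%:E)%E).
Proof.
move=> u0; split=> [h e e0|h].
  have e0' : (0 < e%:E)%E by rewrite lte_fin.
  have [N _ hN] := h _ (open_ereal_lt' e0').
  by exists N => n /hN /ltW.
apply: limn_esup_le_cvg => //; apply/lee_addgt0Pr => e e0; rewrite add0e.
have [N hN] := h e e0; rewrite limn_esup_lim; apply: lime_le.
  exact: is_cvg_esups.
exists N => // n Nn /=; apply: ge_ereal_sup => _ [k /= nk <-].
by apply: hN; exact: leq_trans nk.
Qed.

Lemma sqrE_ge0 v (k : nat) : (0 <= ((v k) ^+ 2)%:E)%E.
Proof. by rewrite lee_fin sqr_ge0. Qed.

Lemma l2sq_ge0 v : (0 <= l2sq v)%E.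
Proof. by apply: nneseries_ge0 => k _ _; exact: sqrE_ge0. Qed.

Lemma sqn_sumE n v :
  (sqn (index_iota 0 n) v)%:E = (\sum_(0 <= k < n) ((v k) ^+ 2)%:E)%E.
Proof. by rewrite /sqn -sumEFin. Qed.

Lemma sqn_le_l2sq n v : ((sqn (index_iota 0 n) v)%:E <= l2sq v)%E.
Proof.
by rewrite sqn_sumE; apply: nneseries_lim_ge => k _ _; exact: sqrE_ge0.
Qed.

Lemma l2sq_le v (c : \bar R) :
  (forall n, (sqn (index_iota 0 n.+1) v)%:E <= c)%E -> (l2sq v <= c)%E.
Proof.
move=> h; apply: lime_le.
  by apply: is_cvg_nneseries => k _ _; exact: sqrE_ge0.
exists 1%N => // -[//|n] _ /=; by rewrite -sqn_sumE.
Qed.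

Lemma le_l2sq u v : (forall k, u k ^+ 2 <= v k ^+ 2) -> (l2sq u <= l2sq v)%E.
Proof.
by move=> uv; apply: lee_nneseries => k _ *; rewrite lee_fin ?uv ?sqr_ge0.
Qed.

Lemma sqr_le_l2sq v k : ((v k ^+ 2)%:E <= l2sq v)%E.
Proof.
apply: le_trans (sqn_le_l2sq k.+1 v); rewrite lee_fin /sqn big_nat_recr//= lerDr.
by apply: sumr_ge0 => i _; exact: sqr_ge0.
Qed.

Lemma normVE v : normV v = (l2sq v `^ 2^-1)%E.
Proof.
rewrite /normV; have := l2sq_ge0 v; case: (l2sq v) => [r| |]//.
  by rewrite lee_fin => r0; rewrite poweR_EFin powR12_sqrt.
by move=> _; rewrite poweRyr// gt_eqF.
Qed.

Lemma normV_ge0 v : (0 <= normV v)%E.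
Proof. by rewrite normVE poweR_ge0. Qed.

Lemma normV_poweR v (p : R) : (normV v `^ p)%E = (l2sq v `^ (p / 2))%E.
Proof. by rewrite normVE -poweRrM mulrC. Qed.

Lemma le_poweR (x y : \bar R) (r : R) : 0 <= r -> (0 <= x)%E -> (x <= y)%E ->
  (x `^ r <= y `^ r)%E.
Proof.
move=> r0 x0 xy; apply: gt0_ler_poweR => //; rewrite in_itv/= ?leey ?andbT//.
exact: le_trans xy.
Qed.

Lemma nrm_le_normV n v : ((nrm (index_iota 0 n) v)%:E <= normV v)%E.
Proof.
rewrite normVE /nrm -powR12_sqrt// -poweR_EFin le_poweR ?lee_fin//.
exact: sqn_le_l2sq.
Qed.

Lemma normV_lt (l : R) v : 0 < l ->
  (l%:E < normV v)%E = ((l ^+ 2)%:E < l2sq v)%E.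
Proof.
move=> l0; rewrite /normV; have := l2sq_ge0 v; case: (l2sq v) => [r| |]//.
  rewrite lee_fin !lte_fin => r0; rewrite -{1}[l]ger0_norm ?(ltW l0)//.
  have [->|rn0] := eqVneq r 0; last by rewrite -sqrtr_sqr ltr_sqrt// lt_def rn0.
  by rewrite sqrtr0 !ltNge sqr_ge0 normr_ge0.
by rewrite !ltry.
Qed.

(** The strict inequality matters: a supremum exceeds [l] only if some partial sum does.
    Distributional bounds for finite lists pass to l^2 through this union. *)
Lemma l2sq_bigcup (f : G -> nat -> R) (l : R) :
  [set x | (l%:E < l2sq (f x))%E] =
  \bigcup_n [set x | l < sqn (index_iota 0 n.+1) (f x)].
Proof.
apply/seteqP; split => x /=.
  move=> h; apply: contrapT => nh; move: h; apply/negP; rewrite -leNgt.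
  apply: l2sq_le => n; rewrite lee_fin leNgt; apply/negP => h; apply: nh.
  by exists n.
by move=> [n _ /= h]; apply: lt_le_trans (sqn_le_l2sq n.+1 _); rewrite lte_fin.
Qed.

Lemma measurable_l2sq (f : G -> nat -> R) :
  (forall k, measurable_fun [set: G] (f^~ k)) ->
  measurable_fun [set: G] (fun x => l2sq (f x)).
Proof.
move=> mf; apply: ge0_emeasurable_sum => [k x _ _|k _]; first exact: sqrE_ge0.
by apply/measurable_EFinP; exact: measurable_funX.
Qed.

Lemma measurable_normV (f : G -> nat -> R) :
  (forall k, measurable_fun [set: G] (f^~ k)) ->
  measurable_fun [set: G] (fun x => normV (f x)).
Proof.
move=> mf; rewrite (_ : (fun x => normV (f x)) = fun x => (l2sq (f x) `^ 2^-1)%E).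
  exact: (measurableT_comp (measurable_poweR 2^-1) (measurable_l2sq mf)).
by apply/funext => x; rewrite normVE.
Qed.

Definition tailV M v : nat -> R := fun k => if (M <= k)%N then v k else 0.

Lemma l2sq_tail M v :
  l2sq (tailV M v) = (\sum_(M <= k <oo) ((v k) ^+ 2)%:E)%E.
Proof.
rewrite /l2sq (nneseries_split 0 M); last by move=> k _; exact: sqrE_ge0.
rewrite add0n big_nat big1 ?add0e.
  rewrite eseries_cond [RHS]eseries_cond.
  by apply: eq_eseriesr => k /= Mk; rewrite /tailV Mk.
move=> k /andP[_ kM]; by rewrite /tailV leqNgt kM expr0n.
Qed.

Lemma l2sq_tail_cvg v : is_l2 v -> (fun M => l2sq (tailV M v)) @ \oo --> 0%E.
Proof.
move=> lv; under eq_fun do rewrite l2sq_tail.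
by apply: nneseries_tail_cvg => // k _; exact: sqrE_ge0.
Qed.

Lemma normV_tail_cvg v : is_l2 v -> (fun M => normV (tailV M v)) @ \oo --> 0%E.
Proof.
move=> /l2sq_tail_cvg h.
apply/ge0_cvge0P => [M|e e0]; first exact: normV_ge0.
have [N hN] := (ge0_cvge0P (fun M => l2sq_ge0 _)).1 h (e ^+ 2) (exprn_gt0 2 e0).
by exists N => n /hN hn; rewrite leNgt normV_lt// -leNgt.
Qed.

End l2.

(** * Haar measure, dyadic averages and integrated supermartingales *)

Section average.
Variables (R : realType) (mu : {measure set G -> \bar R}).
Hypothesis mu_prob : mu setT = 1%E.
Hypothesis mu_haar : forall (a : G) (A : set G), measurable A ->
  mu [set addG a y | y in A] = mu A.

Local Notation integ h := (mu.-integrable setT (EFin \o h)).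

Definition avg n (h : G -> R) x : R := 2 ^+ n * \int[mu]_(y in cyl n x) h y.

Lemma mu_preimage a A : measurable A -> mu (addG a @^-1` A) = mu A.
Proof.
move=> mA; rewrite -(mu_haar a mA); congr (mu _); apply/seteqP; split.
  by move=> x /= ?; exists (addG a x) => //; rewrite addGK.
by move=> _ [y Ay <-] /=; rewrite addGK.
Qed.

Lemma ge0_integral_addG a (h : G -> \bar R) : measurable_fun [set: G] h ->
  (forall x, 0 <= h x)%E -> (\int[mu]_x h (addG a x) = \int[mu]_x h x)%E.
Proof.
move=> mh h0; have ma := measurable_addG a.
pose ma' := isMeasurableFun.Build _ _ G G _ ma.
pose pa : {mfun G >-> G} := MeasurableFun.Pack (MeasurableFun.Class ma').
rewrite [RHS](@eq_measure_integral _ _ _ _ (pushforward mu pa)) => [|A mA _].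
  by rewrite (ge0_integral_pushforward ma).
exact: (esym (mu_preimage a mA)).
Qed.

Lemma integrable_addG a (h : G -> \bar R) : mu.-integrable setT h ->
  mu.-integrable setT (h \o addG a).
Proof.
move=> /integrableP[mh hoo]; apply/integrableP; split.
  exact: (measurableT_comp mh (measurable_addG a)).
rewrite (ge0_integral_addG a (h := fun x => `|h x|)%E)//.
exact: measurableT_comp.
Qed.

Lemma integral_addG a (h : G -> \bar R) : mu.-integrable setT h ->
  (\int[mu]_x h (addG a x) = \int[mu]_x h x)%E.
Proof.
move=> /integrableP[mh _].
rewrite [LHS]integralE [RHS]integralE; congr (_ - _)%E.
  rewrite -[RHS](ge0_integral_addG a (measurable_funepos mh) (funepos_ge0 h)).
  by apply: eq_integral => x _; rewrite !funeposE.
rewrite -[RHS](ge0_integral_addG a (measurable_funeneg mh) (funeneg_ge0 h)).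
by apply: eq_integral => x _; rewrite !funenegE.
Qed.

Lemma Rintegral_addG a (h : G -> R) : integ h ->
  \int[mu]_x h (addG a x) = \int[mu]_x h x.
Proof. by move=> ih; congr fine; rewrite -(integral_addG a ih). Qed.

(** Translation by [unitG n] exchanges the two halves of a level-[n] cylinder, so the measure halves
    at each level. *)
Lemma mu_cyl n x : mu (cyl n x) = ((2 ^+ n)^-1)%:E.
Proof.
elim: n x => [|n ih] x; first by rewrite cyl0 mu_prob expr0 invr1.
have : mu (cyl n x) = (mu (cyl n.+1 x) + mu (cyl n.+1 x))%E.
  rewrite cyl_split measureU//; last by apply/eqP; rewrite -disj_set2E; exact: cyl_disj.
  congr (_ + _)%E; rewrite -(mu_preimage (unitG n))//; congr (mu _).
  apply/seteqP; split => y /= h i hi; have := h i hi;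
    rewrite -?/(flip n y); case: (eqVneq i n) => [->|ni].
  - by rewrite !flip_at => ->; case: (x n).
  - by rewrite !flip_neq.
  - by rewrite !flip_at => <-; case: (y n).
  - by rewrite !flip_neq.
have : (mu (cyl n.+1 x) <= 1)%E.
  by rewrite -mu_prob le_measure// inE.
rewrite ih; case: (mu _) (measure_ge0 mu (cyl n.+1 x)) => [r| |] //= _ _ [] h.
congr EFin; rewrite exprS invfM.
rewrite h; lra.
Qed.

Lemma fin_mu (A : set G) : measurable A -> (mu A < +oo)%E.
Proof.
by move=> mA; rewrite (@le_lt_trans _ _ 1%E) ?ltry// -mu_prob le_measure// inE.
Qed.

Lemma integ_bounded (h : G -> R) M : measurable_fun setT h ->
  (forall x, `|h x| <= M) -> integ h.
Proof.
move=> mh hM; apply: measurable_bounded_integrable => //; first exact: fin_mu.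
exists M; split; first exact: num_real.
by move=> N MN x _ /=; rewrite (le_trans (hM x))// ltW.
Qed.

Lemma integ_adapted n (h : G -> R) : adapted n h -> integ h.
Proof.
move=> ah; have [M _ hM] := adapted_bounded ah.
by apply: (integ_bounded _ hM); exact: adapted_measurable ah.
Qed.

Lemma integ_meas (h : G -> R) : integ h -> measurable_fun [set: G] h.
Proof. by move=> /measurable_int /measurable_EFinP. Qed.

Lemma integZ (c : R) (h : G -> R) : integ h -> integ (fun x => c * h x).
Proof.
move=> ih; apply: (eq_integrable measurableT (fun x => c%:E * (EFin \o h) x)%E) => //.
exact: integrableZl.
Qed.

Lemma integD (h k : G -> R) : integ h -> integ k -> integ (fun x => h x + k x).
Proof.
move=> ih ik; apply: (eq_integrable measurableT ((EFin \o h) \+ (EFin \o k))%E) => //.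
exact: integrableD.
Qed.

Lemma integB (h k : G -> R) : integ h -> integ k -> integ (fun x => h x - k x).
Proof.
move=> ih ik; have := integD ih (integZ (-1) ik).
by apply: eq_integrable => // x _ /=; rewrite mulN1r.
Qed.

Lemma integ_le (h k : G -> R) : measurable_fun [set: G] h ->
  (forall x, `|h x| <= k x) -> integ k -> integ h.
Proof.
move=> mh hk; apply: le_integrable => //; first exact/measurable_EFinP.
by move=> x _; rewrite lee_fin (le_trans (hk x))// ler_norm.
Qed.

Lemma integ_mul_bounded (h b : G -> R) M : integ h -> measurable_fun setT b ->
  (forall x, `|b x| <= M) -> integ (fun x => h x * b x).
Proof.
move=> ih mb bM; have /(integZ M) iMh : integ (fun x => `|h x|).
  exact: integrable_norm.
apply: integ_le iMh; first exact: (measurable_funM (integ_meas ih) mb).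
by move=> x; rewrite normrM mulrC ler_wpM2r.
Qed.

Lemma integ_sub A (h : G -> R) : measurable A -> integ h ->
  mu.-integrable A (EFin \o h).
Proof. by move=> mA; apply: integrableS. Qed.

Lemma adapted_avg n h : adapted n (avg n h).
Proof. by move=> x y xy; rewrite /avg (cyl_eq xy). Qed.

(** The martingale property, in the form used by all the one-step inequalities. *)
Lemma avg_half n h x : integ h ->
  avg n h x = (avg n.+1 h x + avg n.+1 h (flip n x)) / 2.
Proof.
move=> ih; rewrite /avg [in LHS]cyl_split Rintegral_setU//.
- by rewrite -mulrDr exprS; field.
- by apply: integ_sub => //; exact: measurableU.
- exact: cyl_disj.
Qed.

Lemma avg0 h x : avg 0 h x = \int[mu]_y h y.
Proof. by rewrite /avg cyl0 expr0 mul1r. Qed.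

Lemma Rint_cst (c : R) : \int[mu]_x c = c.
Proof. by rewrite Rintegral_cst// mu_prob mulr1. Qed.

(* The integral of an adapted function does not change when it is averaged over
   a coordinate flip, so the one-step inequality integrates. *)
Lemma supermartingale_int (F : nat -> G -> R) n x :
  (forall m, adapted m (F m)) ->
  (forall m y, (F m.+1 y + F m.+1 (flip m y)) / 2 <= F m y) ->
  \int[mu]_y F n y <= F 0%N x.
Proof.
move=> aF hF; elim: n => [|n ih].
  rewrite (adapted0 (aF 0%N)) /= Rint_cst.
  exact: lexx.
apply: le_trans ih; have i1 := integ_adapted (aF n.+1).
have i2 : integ (F n.+1 \o flip n).
  exact: (@integrable_addG (unitG n) (EFin \o F n.+1)).
have -> : \int[mu]_y F n.+1 y =
    \int[mu]_y ((F n.+1 y + F n.+1 (flip n y)) * 2^-1).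
  rewrite RintegralZr//; last exact: integD.
  rewrite RintegralD// (_ : \int[mu]_y _ (flip n y) = \int[mu]_y F n.+1 y).
    by field.
  exact: Rintegral_addG.
apply: le_Rintegral => //; last exact: integ_adapted (aF n).
by have := integZ 2^-1 (integD i1 i2); apply: eq_integrable => // y _ /=; rewrite mulrC.
Qed.

(** Both the averages and their negatives satisfy the one-step inequality, with equality, so
    [supermartingale_int] gives both bounds. *)
Lemma int_avg n h : integ h -> \int[mu]_x avg n h x = \int[mu]_x h x.
Proof.
move=> ih; apply/eqP; rewrite eq_le; apply/andP; split.
  rewrite -(avg0 h emptyG); apply: (@supermartingale_int (avg^~ h)).
    by move=> m; exact: adapted_avg.
  by move=> m y; rewrite (avg_half m y ih) lexx.
rewrite -lerN2 -(avg0 h emptyG).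
have := @supermartingale_int (fun n x => - avg n h x) n emptyG.
have -> : \int[mu]_y (- avg n h y) = - \int[mu]_y avg n h y.
  under eq_Rintegral do rewrite -mulN1r.
  rewrite RintegralZl//; first by rewrite mulN1r.
  exact: integ_adapted (@adapted_avg n h).
apply => [m x y xy|m y]; first by rewrite (adapted_avg h xy).
by rewrite (avg_half m y ih); lra.
Qed.

Lemma avg_pull n h b x : integ h -> adapted n b ->
  avg n (fun y => b y * h y) x = b x * avg n h x.
Proof.
move=> ih ab; rewrite /avg (eq_Rintegral _ (g := fun y => b x * h y)).
  by rewrite RintegralZl//; [rewrite mulrCA|exact: integ_sub].
by move=> y /set_mem xy; rewrite (ab _ _ xy).
Qed.

Lemma le_avg n h k x : integ h -> integ k -> (forall y, h y <= k y) ->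
  avg n h x <= avg n k x.
Proof.
move=> ih ik hk; rewrite /avg ler_wpM2l ?exprn_ge0//.
by apply: le_Rintegral => //; exact: integ_sub.
Qed.

Lemma avgD n h k x : integ h -> integ k ->
  avg n (fun y => h y + k y) x = avg n h x + avg n k x.
Proof.
by move=> ih ik; rewrite /avg RintegralD ?mulrDr//; exact: integ_sub.
Qed.

Lemma avgB n h k x : integ h -> integ k ->
  avg n (fun y => h y - k y) x = avg n h x - avg n k x.
Proof.
by move=> ih ik; rewrite /avg RintegralB ?mulrBr//; exact: integ_sub.
Qed.

Lemma avgZ n (c : R) h x : integ h ->
  avg n (fun y => c * h y) x = c * avg n h x.
Proof. by move=> ih; rewrite (@avg_pull n h (cst c))// => ? ?. Qed.

Lemma avg_cst n (c : R) x : avg n (cst c) x = c.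
Proof.
rewrite /avg Rintegral_cst// mu_cyl /= mulrC -mulrA mulVf ?mulr1//.
Qed.

Lemma integ_avg n h : integ (avg n h).
Proof. exact: integ_adapted (@adapted_avg n h). Qed.

(** The indicator of the coarse cylinder is adapted at level [n], so it moves inside [avg n], which
    preserves integrals. *)
Lemma avg_tower m n h x : (m <= n)%N -> integ h ->
  avg m (avg n h) x = avg m h x.
Proof.
move=> mn ih; pose b (y : G) : R := \1_(cyl m x) y.
have ab : adapted n b.
  apply: (adaptedW mn) => y z yz; rewrite /b !indicE; congr (_%:R).
  apply: congr1; apply/idP/idP; rewrite !inE => h1 i im.
    by rewrite -h1// yz.
  by rewrite yz// h1.
have restr k : k \_ (cyl m x) = fun y => b y * k y.
  apply/funext => y; rewrite patchE /b indicE; case: ifP => _; first by rewrite mul1r.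
  by rewrite mul0r.
rewrite /avg; congr (_ * _).
rewrite Rintegral_mkcond [RHS]Rintegral_mkcond !restr.
rewrite -[RHS](@int_avg n).
  by apply: eq_Rintegral => y _; rewrite avg_pull.
have [M _ hM] := adapted_bounded ab.
have := integ_mul_bounded ih (adapted_measurable ab) hM.
by apply: eq_integrable => // y _ /=; rewrite mulrC.
Qed.

Lemma avg_id m n h x : (m <= n)%N -> adapted m h -> avg n h x = h x.
Proof.
move=> mn ah.
have -> : h = fun y => h y * cst 1 y by apply/funext => y; rewrite mulr1.
rewrite avg_pull ?avg_cst//; last exact: adaptedW ah.
by apply: (@integ_adapted 0) => ? ?.
Qed.

(** Averaging either product pulls out its adapted factor, so both sides equal the integral of the
    product of the two averages. *)
Lemma avg_sym n (h b : G -> R) M : integ h -> measurable_fun setT b ->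
  (forall x, `|b x| <= M) ->
  \int[mu]_x (avg n h x * b x) = \int[mu]_x (h x * avg n b x).
Proof.
move=> ih mb bM; have ib := integ_bounded mb bM.
have aa k := @adapted_avg n k.
have [Mh _ hMh] := adapted_bounded (aa h).
have [Mb _ hMb] := adapted_bounded (aa b).
rewrite -[LHS](@int_avg n); last first.
  by apply: integ_mul_bounded bM => //; exact: integ_avg.
rewrite -[RHS](@int_avg n); last first.
  by apply: integ_mul_bounded hMb => //; exact: adapted_measurable (aa b).
apply: eq_Rintegral => x _; rewrite avg_pull//.
rewrite (_ : (fun y => _) = fun y => avg n b y * h y).
  by rewrite avg_pull// mulrC.
by apply/funext => y; rewrite mulrC.
Qed.

(** * Square function inequalities *)

Definition vavg n (f : G -> nat -> R) (x : G) : nat -> R :=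
  fun k => avg n (f^~ k) x.

(** The initial term makes the square function dominate coordinate 0 of the operator as well, and
    starts U at a point where [y] is |v|^2 and U is nonpositive. *)
Definition sqf s (f : G -> nat -> R) n (x : G) : R :=
  sqn s (vavg 0 f x) +
  \sum_(j < n) sqn s (fun k => vavg j.+1 f x k - vavg j f x k).

Lemma adapted_vavg n f : adapted n (vavg n f).
Proof. by move=> x y xy; apply/funext => k; exact: adapted_avg xy. Qed.

Lemma adapted_sqf s f n : adapted n (sqf s f n).
Proof.
move=> x y xy; rewrite /sqf (adaptedW (leq0n n) (@adapted_vavg 0 f) xy).
congr (_ + _); apply: eq_bigr => j _.
rewrite (adaptedW (ltn_ord j) (@adapted_vavg j.+1 f) xy).
by rewrite (adaptedW (ltnW (ltn_ord j)) (@adapted_vavg j f) xy).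
Qed.

Lemma sqf_ge0 s f n x : 0 <= sqf s f n x.
Proof. by apply: addr_ge0 => //; apply: sumr_ge0. Qed.

Lemma sqfS s f n x : sqf s f n.+1 x =
  sqf s f n x + sqn s (fun k => vavg n.+1 f x k - vavg n f x k).
Proof. by rewrite /sqf big_ord_recr /= addrA. Qed.

Lemma bellman s f (U : (nat -> R) -> R -> R) n x : (forall k, integ (f^~ k)) ->
  (forall v d y, 0 <= y ->
    (U (fun k => v k + d k)%R (y + sqn s d) +
     U (fun k => v k - d k) (y + sqn s d)) / 2 <= U v y) ->
  \int[mu]_z U (vavg n f z) (sqf s f n z) <=
  U (vavg 0 f x) (sqn s (vavg 0 f x)).
Proof.
move=> fi hU; have -> : sqn s (vavg 0 f x) = sqf s f 0 x.
  by rewrite /sqf big_ord0 addr0.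
apply: (@supermartingale_int (fun m z => U (vavg m f z) (sqf s f m z))).
  by move=> m y z yz; rewrite (adapted_vavg f yz) (adapted_sqf s f yz).
move=> m y; pose d k := vavg m.+1 f y k - vavg m f y k.
have e1 : vavg m.+1 f y = fun k => vavg m f y k + d k.
  by apply/funext => k; rewrite /d addrC subrK.
have e2 : vavg m.+1 f (flip m y) = fun k => vavg m f y k - d k.
  apply/funext => k; rewrite /d /vavg.
  have := avg_half m y (fi k); lra.
(* Predictability: the flip only reverses the sign of [d]. *)
have e3 : sqf s f m.+1 (flip m y) = sqf s f m y + sqn s d.
  rewrite sqfS (adapted_flip y (adapted_sqf s f (n := m)) (leqnn m)).
  congr (_ + _); rewrite e2 (adapted_flip y (adapted_vavg f (n := m)) (leqnn m)).
  by rewrite /sqn; apply: eq_bigr => k _; ring.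
rewrite sqfS -/d e3 e2 e1 -/d; apply: hU; exact: sqf_ge0.
Qed.

Lemma measurable_sqn s (f : G -> nat -> R) :
  (forall k, measurable_fun [set: G] (f^~ k)) ->
  measurable_fun [set: G] (fun x => sqn s (f x)).
Proof.
by move=> mf; apply: measurable_sum => k; exact: measurable_funX.
Qed.

Lemma measurable_nrm s (f : G -> nat -> R) :
  (forall k, measurable_fun [set: G] (f^~ k)) ->
  measurable_fun [set: G] (fun x => nrm s (f x)).
Proof.
move=> mf; have -> : (fun x => nrm s (f x)) = (fun x => sqn s (f x) `^ 2^-1).
  by apply/funext => x; rewrite powR12_sqrt.
exact: (measurableT_comp (measurable_powR 2^-1) (measurable_sqn s mf)).
Qed.

Lemma integ_sum s (h : nat -> G -> R) : (forall k, integ (h k)) ->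
  integ (fun x => \sum_(k <- s) h k x).
Proof.
move=> ih; elim: s => [|k s IH].
  apply: (@integ_adapted 0) => x y _; by rewrite !big_nil.
have := integD (ih k) IH; apply: eq_integrable => // x _ /=.
by rewrite big_cons.
Qed.

Lemma integ_nrm s f : (forall k, integ (f^~ k)) -> integ (fun x => nrm s (f x)).
Proof.
move=> fi; apply: (@integ_le _ (fun x => \sum_(k <- s) `|f x k|)).
- by apply: measurable_nrm => k; exact: integ_meas.
- by move=> x; rewrite ger0_norm// nrm_le_sum.
- by apply: integ_sum => k; exact: integrable_norm.
Qed.

Lemma avg_sum n s (h : nat -> G -> R) x : (forall k, integ (h k)) ->
  avg n (fun y => \sum_(k <- s) h k y) x = \sum_(k <- s) avg n (h k) x.
Proof.
move=> ih; elim: s => [|k s IH].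
  under [in LHS]eq_fun do rewrite big_nil.
  by rewrite big_nil avg_cst.
under [in LHS]eq_fun do rewrite big_cons.
by rewrite big_cons avgD// ?IH//; exact: integ_sum.
Qed.

Lemma avg_ge0 n h x : (forall y, 0 <= h y) -> 0 <= avg n h x.
Proof. by move=> h0; rewrite mulr_ge0 ?exprn_ge0// Rintegral_ge0. Qed.

(* Minkowski's inequality, by pairing the average with itself. *)
Lemma nrm_vavg s f n x : (forall k, integ (f^~ k)) ->
  nrm s (vavg n f x) <= avg n (fun y => nrm s (f y)) x.
Proof.
move=> fi; set e := vavg n f x.
have [e0|e0] := eqVneq (nrm s e) 0; first by rewrite e0 avg_ge0.
have egt0 : 0 < nrm s e by rewrite lt_neqAle eq_sym e0 nrm_ge0.
rewrite -(ler_pM2l egt0) -expr2 nrm_sqr -avgZ; last exact: integ_nrm.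
have -> : sqn s e = avg n (fun y => \sum_(k <- s) e k * f y k) x.
  rewrite (avg_sum _ _ _ (h := fun k y => e k * f y k)).
    by apply: eq_bigr => k _; rewrite avgZ.
  by move=> k; exact: integZ.
apply: le_avg => [||y]; last exact: dot_le_nrm.
- by apply: (integ_sum _ (h := fun k y => e k * f y k)) => k; exact: integZ.
- by apply: integZ; exact: integ_nrm.
Qed.

(** Average the tangent inequality at the point [avg n h x]; its linear term averages to zero. *)
Lemma avg_jensen (p : R) n h x : 1 <= p -> (forall y, 0 <= h y) -> integ h ->
  integ (fun y => h y `^ p) -> avg n h x `^ p <= avg n (fun y => h y `^ p) x.
Proof.
move=> p1 h0 ih ihp; set a := avg n h x.
have a0 : 0 <= a by exact: avg_ge0.
have ic c : integ (cst c) by apply: (@integ_adapted 0).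
have i1 := integB ih (ic a).
have i2 := integZ (p * a `^ (p - 1)) i1.
have i3 := integD (ic (a `^ p)) i2.
have -> : a `^ p = avg n (fun y => cst (a `^ p) y + p * a `^ (p - 1) * (h y - cst a y)) x.
  by rewrite avgD// avgZ// avgB// !avg_cst subrr mulr0 addr0.
by apply: le_avg => // y; exact: powR_tangent.
Qed.

Lemma int_indic A : measurable A -> \int[mu]_x (\1_A x : R) = fine (mu A).
Proof. by move=> mA; rewrite /Rintegral integral_indic// setIT. Qed.

Lemma integ_indic A : measurable A -> integ (\1_A : G -> R).
Proof.
move=> mA; apply: (@integ_bounded _ 1); first exact: measurable_indic.
by move=> x; rewrite indicE; case: (_ \in _); rewrite ?normr1 ?normr0.
Qed.

Lemma weak_type_sqf s f n l : 0 < l -> (forall k, integ (f^~ k)) ->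
  l * fine (mu [set x | l ^+ 2 <= sqf s f n x]) <= 2 * \int[mu]_x nrm s (f x).
Proof.
move=> l0 fi; set A := [set x | _].
have mA : measurable A.
  apply: (@adapted_measurable_set n) => x y xy.
  by rewrite (adapted_sqf s f xy).
have av : integ (fun x => nrm s (vavg n f x)).
  by apply: (@integ_adapted n) => x y xy; rewrite (adapted_vavg f xy).
have := bellman n emptyG fi (fun v d y => @weakU_supermartingale R s l v d y l0).
move=> /le_trans /(_ (weakU_init _ _ l0)) h.
(* The slope [2 * l] of the outer branch of [weakU] becomes the constant 2 once a factor [l] is
   cancelled. *)
have h1 : \int[mu]_x (l ^+ 2 * \1_A x - 2 * l * nrm s (vavg n f x)) <= 0.
  apply: le_trans h; apply: le_Rintegral => //.
  - by apply: integB; apply: integZ => //; exact: integ_indic.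
  - apply: (@integ_adapted n) => x y xy.
    by rewrite (adapted_vavg f xy) (adapted_sqf s f xy).
  - move=> x _; apply: le_trans (weakU_final s (vavg n f x) l0 (sqf_ge0 s f n x)).
    rewrite lerD2r indicE; case: ifPn => xA.
      by rewrite mem_set// mulr1.
    by rewrite memNset ?mulr0//; exact/negP.
rewrite RintegralB// ?RintegralZl// ?int_indic// in h1; last 3 first.
- exact: integ_indic.
- by apply: integZ; exact: integ_indic.
- exact: integZ.
have h2 : \int[mu]_x nrm s (vavg n f x) <= \int[mu]_x nrm s (f x).
  rewrite -(int_avg n (integ_nrm s fi)); apply: le_Rintegral => //.
    exact: integ_avg.
  by move=> x _; exact: nrm_vavg.
rewrite -(ler_pM2l l0); move: h1 h2.
set a := fine _; set b := \int[mu]_x _; set c := \int[mu]_x _ => h1 h2.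
have : l * b <= l * c by rewrite ler_pM2l.
rewrite expr2 in h1; lra.
Qed.

Lemma maximal_ineq (X : nat -> G -> R) n l :
  (forall m, adapted m (X m)) -> (forall m x, 0 <= X m x) ->
  (forall m x, X m x <= (X m.+1 x + X m.+1 (flip m x)) / 2) ->
  l * fine (mu [set x | has (fun i => l <= X i x) (iota 0 n.+1)]) <=
  \int[mu]_x X n x.
Proof.
move=> aX X0 sX; pose B m x := has (fun i => l <= X i x) (iota 0 m.+1).
have aB m : adapted m (B m).
  move=> x y xy; apply: eq_in_has => i; rewrite mem_iota add0n => /andP[_ im].
  by rewrite (adaptedW _ (aX i) xy).
have BS m x : B m.+1 x = B m x || (l <= X m.+1 x).
  by rewrite /B -[in LHS]addn1 iotaD has_cat /= add0n orbF.
(* Doob's argument without a stopping time: [F] is 0 until level [l] is reached, nonpositive when it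
   is first reached, and afterwards [l] minus a submartingale. Hence [F] is a supermartingale with
   nonpositive start. *)
pose F m x := if B m x then l - X m x else 0.
have h : \int[mu]_x F n x <= 0.
  have F00 x : F 0%N x <= 0.
    rewrite /F /B /= orbF; case: ifP => //; lra.
  apply: le_trans (F00 emptyG); apply: supermartingale_int => [m x y xy|m y].
    by rewrite /F (aB _ _ _ xy) (aX _ _ _ xy).
  rewrite /F !BS (adapted_flip y (aB m) (leqnn m)).
  have := sX m y; case: (B m y) => /=; first by lra.
  by move=> _; case: ifP; case: ifP; lra.
set A := [set x | _].
have mA : measurable A by exact: adapted_measurable_set (aB n).
have iX := integ_adapted (aX n); have iA := integ_indic mA.
rewrite -subr_le0; apply: le_trans h.
rewrite -int_indic// -RintegralZl// -RintegralB//; last exact: integZ.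
apply: le_Rintegral => //.
- by apply: integB => //; exact: integZ.
- by apply: (@integ_adapted n) => x y xy; rewrite /F (aB _ _ _ xy) (aX _ _ _ xy).
move=> x _; rewrite /F indicE; case: ifPn => xA; first by rewrite mem_set// mulr1.
by rewrite memNset ?mulr0 ?sub0r ?oppr_le0//; exact/negP.
Qed.

Lemma sqf_Lp q s f n : 1 <= q -> (forall k, integ (f^~ k)) ->
  integ (fun x => sqn s (f x) `^ q) ->
  \int[mu]_x (sqf s f n x `^ q) <=
  2 * (q * (2 * q) `^ (q - 1)) * \int[mu]_x (sqn s (f x) `^ q).
Proof.
move=> q1 fi fq; set C := q * _.
have C0 : 0 <= C by rewrite mulr_ge0 ?powR_ge0//; lra.
have := bellman n emptyG fi (fun v d y => @powU_supermartingale R s q v d y q1).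
move=> /le_trans /(_ (powU_init _ _ q1)) h.
have i1 : integ (fun x => sqf s f n x `^ q).
  by apply: (@integ_adapted n) => x y xy; rewrite (adapted_sqf s f xy).
have i2 : integ (fun x => sqn s (vavg n f x) `^ q).
  by apply: (@integ_adapted n) => x y xy; rewrite (adapted_vavg f xy).
have h1 : \int[mu]_x (2^-1 * (sqf s f n x `^ q) - C * (sqn s (vavg n f x) `^ q)) <= 0.
  apply: le_trans h; apply: le_Rintegral => //.
  - by apply: integB; exact: integZ.
  - apply: (@integ_adapted n) => x y xy.
    by rewrite (adapted_vavg f xy) (adapted_sqf s f xy).
  - move=> x _; rewrite mulrC; exact: powU_final (sqf_ge0 _ _ _ _).
rewrite RintegralB// ?RintegralZl// in h1; [|exact: integZ..].
have h2 : \int[mu]_x (sqn s (vavg n f x) `^ q) <= \int[mu]_x (sqn s (f x) `^ q).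
  rewrite -(int_avg n fq); apply: le_Rintegral => //; first exact: integ_avg.
  move=> x _; have e v : sqn s v `^ q = nrm s v `^ (q * 2).
    by rewrite nrm_powR mulfK.
  rewrite e; under eq_fun do rewrite e.
  have q2 : 1 <= q * 2 by clear -q1; lra.
  have fq' : integ (fun y => nrm s (f y) `^ (q * 2)).
    by move: fq; apply: eq_integrable => // y _ /=; rewrite e.
  have := avg_jensen n x q2 (fun y => nrm_ge0 s (f y)) (integ_nrm s fi) fq'.
  apply: le_trans; apply: ge0_ler_powR; rewrite ?nnegrE ?avg_ge0//; first exact: le_trans q2.
  exact: nrm_vavg.
have /(_ _ _ h2) h3 := @ler_wpM2l _ C C0.
move: h1 h3; clearbody C; clear.
move: (\int[mu]_x _) (\int[mu]_x _) (\int[mu]_x _) => a b c; lra.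
Qed.

(* [dif n] is Delta_n, and [tf] the candidate (Delta_n f_n)_n for the principal
   value. *)
Definition dif n (h : G -> R) (x : G) : R :=
  if n is m.+1 then avg n h x - avg m h x else avg 0 h x.

Definition tf (f : G -> nat -> R) (x : G) : nat -> R :=
  fun k => dif k (f^~ k) x.

(** * The diagonal operator [tf] and its power bounds *)

Local Notation seg n := (index_iota 0 n.+1).

Lemma adapted_dif n h : adapted n (dif n h).
Proof.
case: n => [|n] x y xy /=; first by rewrite (adapted_avg h xy).
by rewrite (adapted_avg h xy) (adaptedW (leqnSn n) (adapted_avg h (n := n)) xy).
Qed.

Lemma integ_dif n h : integ (dif n h).
Proof. exact: integ_adapted (@adapted_dif n h). Qed.

Lemma adapted_tf n f k : (k <= n)%N -> adapted n (fun x => tf f x k).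
Proof. by move=> kn; apply: (adaptedW kn); exact: adapted_dif. Qed.

Lemma adapted_sqn_tf n f : adapted n (fun x => sqn (seg n) (tf f x)).
Proof.
move=> x y xy; apply: eq_big_seq => k; rewrite mem_index_iota ltnS => /andP[_ kn].
by rewrite (adapted_tf f kn xy).
Qed.

Lemma dif_sym n (h b : G -> R) M : integ h -> measurable_fun [set: G] b ->
  (forall x, `|b x| <= M) ->
  \int[mu]_x (dif n h x * b x) = \int[mu]_x (h x * dif n b x).
Proof.
move=> ih mb bM; case: n => [|n] /=; first exact: avg_sym bM.
have ia (k : G -> R) : integ k -> forall c : G -> R, measurable_fun [set: G] c ->
    (exists M, forall x, `|c x| <= M) -> integ (fun x => k x * c x).
  by move=> ik c mc [N hN]; exact: integ_mul_bounded hN.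
have bd m : exists M, forall x, `|avg m b x| <= M.
  by have [N _ hN] := adapted_bounded (@adapted_avg m b); exists N.
have ma m : measurable_fun [set: G] (avg m b).
  exact: adapted_measurable (@adapted_avg m b).
have eb : exists M, forall x, `|b x| <= M by exists M.
under eq_Rintegral do rewrite mulrBl.
under [RHS]eq_Rintegral do rewrite mulrBr.
rewrite RintegralB//; [|by apply: ia => //; exact: integ_avg..].
by rewrite RintegralB//; [|by apply: ia..]; rewrite !(avg_sym _ ih mb bM).
Qed.

Lemma dif_idem n h x : integ h -> dif n (dif n h) x = dif n h x.
Proof.
case: n => [|n] ih /=.
  exact: (avg_id _ (leqnn 0) (@adapted_avg 0 h)).
rewrite (avg_id _ (leqnn n.+1) (@adapted_dif n.+1 h)).
by rewrite avgB ?avg_tower ?subrr ?subr0//; exact: integ_avg.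
Qed.

Lemma sqr_le_sqn s (v : nat -> R) k : k \in s -> v k ^+ 2 <= sqn s v.
Proof.
move=> ks; rewrite /sqn (big_rem k ks)/= lerDl sumr_ge0// => i _; exact: sqr_ge0.
Qed.

(** Coordinate [k] of [tf f x] is coordinate [k] of the [k]-th martingale difference: each
    difference contributes just one of its entries. *)
Lemma sqn_tf_le n f x : sqn (seg n) (tf f x) <= sqf (seg n) f n x.
Proof.
rewrite {1}/sqn big_nat_recl// /sqf lerD//.
  exact: (@sqr_le_sqn _ (vavg 0 f x)).
rewrite big_mkord; apply: ler_sum => j _.
apply: (@sqr_le_sqn _ (fun k => vavg j.+1 f x k - vavg j f x k)).
by rewrite mem_index_iota /= ltnS.
Qed.

Lemma tf_Lp_ge1 q n f : 1 <= q -> (forall k, integ (f^~ k)) ->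
  integ (fun x => sqn (seg n) (f x) `^ q) ->
  \int[mu]_x (sqn (seg n) (tf f x) `^ q) <=
  2 * (q * (2 * q) `^ (q - 1)) * \int[mu]_x (sqn (seg n) (f x) `^ q).
Proof.
move=> q1 fi fq; apply: le_trans (sqf_Lp n q1 fi fq).
apply: le_Rintegral => //.
- by apply: (@integ_adapted n) => x y xy; rewrite (adapted_sqn_tf f xy).
- by apply: (@integ_adapted n) => x y xy; rewrite (adapted_sqf _ f xy).
- move=> x _; apply: ge0_ler_powR; rewrite ?nnegrE ?sqf_ge0 ?sqn_tf_le//.
  exact: le_trans q1.
Qed.

Lemma Rint_sum s (h : nat -> G -> R) : (forall k, integ (h k)) ->
  \int[mu]_x (\sum_(k <- s) h k x) = \sum_(k <- s) \int[mu]_x h k x.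
Proof.
move=> ih; rewrite -(avg0 _ emptyG) avg_sum//.
by apply: eq_bigr => k _; rewrite avg0.
Qed.

(* Duality against |Tf|^(p-2) Tf, with p = 2q and conjugate exponent 2q'. *)
Lemma tf_duality q q' C n f : 2^-1 < q -> q' = q / (2 * q - 1) -> 0 < C ->
  (forall g, (forall k, integ (g^~ k)) ->
    integ (fun x => sqn (seg n) (g x) `^ q') ->
    \int[mu]_x (sqn (seg n) (tf g x) `^ q') <=
    C * \int[mu]_x (sqn (seg n) (g x) `^ q')) ->
  (forall k, integ (f^~ k)) -> integ (fun x => sqn (seg n) (f x) `^ q) ->
  \int[mu]_x (sqn (seg n) (tf f x) `^ q) <=
  ((q' / C) `^ (2 * q')^-1)^-1 `^ (2 * q) / q *
    \int[mu]_x (sqn (seg n) (f x) `^ q).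
Proof.
move=> q2 q'E C0 hC fi fq.
have q0 : 0 < q by rewrite (lt_trans _ q2).
have d0 : 0 < 2 * q - 1 by clear -q2; lra.
have q'0 : 0 < q' by rewrite q'E divr_gt0.
pose s := seg n; pose X x := sqn s (tf f x).
have X0 x : 0 <= X x by exact: sqn_ge0.
have aX : adapted n X by exact: adapted_sqn_tf.
(* Cutting off above [n] makes every coordinate adapted at level [n], hence bounded, so all pairings
   below are integrable. *)
pose g x k : R := if (k <= n)%N then X x `^ (q - 1) * tf f x k else 0.
have ag k : adapted n (g^~ k).
  move=> x y xy; rewrite /g (aX _ _ xy); case: ifP => // kn.
  by rewrite (adapted_tf f kn xy).
have gi k : integ (g^~ k) by exact: integ_adapted (ag k).
have in_s k : (k \in s) = (k <= n)%N by rewrite mem_index_iota ltnS.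
have gE x : sqn s (g x) = X x `^ (2 * q - 1).
  have -> : sqn s (g x) = X x `^ (q - 1) ^+ 2 * X x.
    rewrite /X {3}/sqn mulr_sumr; apply: eq_big_seq => k; rewrite in_s => kn.
    by rewrite /g kn exprMn.
  (* Adding exponents requires a nonzero base, as [q - 1] may be negative; at 0 both sides vanish
     because [2 * q - 1] is positive. *)
  have [->|Xx] := eqVneq (X x) 0.
    by rewrite mulr0 powR0// gt_eqF.
  rewrite -{2}[X x]powRr1// expr2 -!powRD ?Xx ?implybT//.
  by congr (_ `^ _); ring.
have gq' x : sqn s (g x) `^ q' = X x `^ q.
  by rewrite gE -powRrM q'E mulrCA mulfV ?mulr1// gt_eqF.
have iX : integ (fun x => X x `^ q).
  by apply: (@integ_adapted n) => x y xy; rewrite (aX _ _ xy).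
have itg : integ (fun x => sqn s (tf g x) `^ q').
  by apply: (@integ_adapted n) => x y xy; rewrite (adapted_sqn_tf g xy).
have hg : \int[mu]_x (sqn s (tf g x) `^ q') <= C * \int[mu]_x (X x `^ q).
  apply: le_trans (hC g gi _) _.
    by move: iX; apply: eq_integrable => // x _ /=; rewrite gq'.
  by under eq_Rintegral do rewrite gq'.
have bdif k : exists M, forall x, `|tf g x k| <= M.
  by have [M _ hM] := adapted_bounded (@adapted_dif k (g^~ k)); exists M.
(* The power integral is the pairing of [tf f] with [g], and self-adjointness of each Delta_k moves
   the operator onto [g]. *)
have e1 : \int[mu]_x (X x `^ q) = \int[mu]_x (\sum_(k <- s) f x k * tf g x k).
  rewrite (@Rint_sum s (fun k x => f x k * tf g x k)); last first.
    move=> k; have [M hM] := bdif k; apply: integ_mul_bounded hM => //.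
    exact: adapted_measurable (@adapted_dif k (g^~ k)).
  transitivity (\sum_(k <- s) \int[mu]_x (tf f x k * g x k)); last first.
    apply: eq_bigr => k _; have [M _ hM] := adapted_bounded (ag k).
    exact: dif_sym (fi k) (adapted_measurable (ag k)) hM.
  rewrite -(@Rint_sum s (fun k x => tf f x k * g x k)); last first.
    move=> k; have [M _ hM] := adapted_bounded (ag k).
    by apply: integ_mul_bounded hM; [exact: integ_dif|exact: adapted_measurable (ag k)].
  apply: eq_Rintegral => x _; rewrite -mulr_powRB1// {1}/X /sqn mulr_suml.
  apply: eq_big_seq => k; rewrite in_s /g => ->; ring.
(* Scaling parameter for Young's inequality: it turns the coefficient of the [tf g] term into
   [(2 * C)^-1], so by [hg] that term is at most half of the left side and is absorbed. *)
pose e := (q' / C) `^ (2 * q')^-1.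
have e0 : 0 < e by rewrite powR_gt0// divr_gt0.
have eE : e `^ (2 * q') = q' / C.
  rewrite /e -powRrM mulVf ?powRr1//; first by rewrite ltW// divr_gt0.
  by rewrite gt_eqF// mulr_gt0.
have conj : (2 * q)^-1 + (2 * q')^-1 = 1.
  by rewrite q'E; field; rewrite !gt_eqF.
have yg x : \sum_(k <- s) f x k * tf g x k <=
    e^-1 `^ (2 * q) / (2 * q) * sqn s (f x) `^ q +
    (2 * C)^-1 * sqn s (tf g x) `^ q'.
  apply: le_trans (dot_le_nrm _ _ _) _.
  have -> : nrm s (f x) * nrm s (tf g x) =
      (e^-1 * nrm s (f x)) * (e * nrm s (tf g x)).
    by rewrite mulrACA mulVf ?mul1r// gt_eqF.
  have ei0 : 0 <= e^-1 by rewrite invr_ge0 ltW.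
  apply: le_trans (conjugate_powR _ _ _ _ conj) _ => //;
    rewrite ?mulr_ge0 ?mulr_gt0 ?(ltW e0)//.
  rewrite !powRM ?(ltW e0)// eE !nrm_powR.
  rewrite [2 * q / 2]mulrAC [2 * q' / 2]mulrAC !divff// !mul1r.
  rewrite [_ * _ / (2 * q)]mulrAC lerD2l le_eqVlt; apply/orP; left; apply/eqP.
  by field; rewrite !gt_eqF.
have : \int[mu]_x (X x `^ q) <= e^-1 `^ (2 * q) / (2 * q) *
    \int[mu]_x (sqn s (f x) `^ q) +
    (2 * C)^-1 * \int[mu]_x (sqn s (tf g x) `^ q').
  rewrite {1}e1 -!RintegralZl// -RintegralD//; [|exact: integZ..].
  apply: le_Rintegral => //; last by apply: integD; exact: integZ.
  apply: (integ_sum _ (h := fun k x => f x k * tf g x k)) => k.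
  have [M hM] := bdif k; apply: integ_mul_bounded hM => //.
  exact: adapted_measurable (@adapted_dif k (g^~ k)).
have : (2 * C)^-1 * \int[mu]_x (sqn s (tf g x) `^ q') <=
    2^-1 * \int[mu]_x (X x `^ q).
  apply: le_trans (ler_wpM2l _ hg) _; first by rewrite invr_ge0 mulr_ge0// ltW.
  by rewrite invfM mulrA -[2^-1 / C * C]mulrA mulVf ?gt_eqF// mulr1.
rewrite (_ : e^-1 `^ (2 * q) / (2 * q) = 2^-1 * (e^-1 `^ (2 * q) / q)); last first.
  by rewrite invfM mulrCA.
rewrite -/e -/s -/(X _); move: (e^-1 `^ (2 * q) / q) => K.
change (fun x => sqn s (tf f x) `^ q) with (fun x => X x `^ q).
move: (\int[mu]_x (X x `^ q)) (_ * \int[mu]_x (sqn s (tf g x) `^ q')).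
move: (\int[mu]_x (sqn s (f x) `^ q)) => a b c; clear; lra.
Qed.

(** [C] is chosen before [n], which allows the later passage to infinitely many coordinates. Here
    [q] is half the Lebesgue exponent. *)
Lemma tf_Lp q : 2^-1 < q -> exists2 C, 0 < C & forall n f,
  (forall k, integ (f^~ k)) -> integ (fun x => sqn (seg n) (f x) `^ q) ->
  \int[mu]_x (sqn (seg n) (tf f x) `^ q) <=
  C * \int[mu]_x (sqn (seg n) (f x) `^ q).
Proof.
move=> q2; have q0 : 0 < q by rewrite (lt_trans _ q2).
have Cgt0 (r : R) : 1 <= r -> 0 < 2 * (r * (2 * r) `^ (r - 1)).
  move=> r1; have r0 : 0 < r by exact: lt_le_trans r1.
  by rewrite !mulr_gt0// powR_gt0// mulr_gt0.
have [q1|q1] := leP 1 q.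
  exists (2 * (q * (2 * q) `^ (q - 1))); first exact: Cgt0.
  by move=> n f fi fq; exact: tf_Lp_ge1.
have d0 : 0 < 2 * q - 1 by clear -q2; lra.
pose q' := q / (2 * q - 1); pose C := 2 * (q' * (2 * q') `^ (q' - 1)).
have q'1 : 1 <= q' by rewrite /q' ler_pdivlMr// mul1r; clear -q1; lra.
have q'0 : 0 < q' by exact: lt_le_trans q'1.
have C0 : 0 < C by exact: Cgt0.
exists (((q' / C) `^ (2 * q')^-1)^-1 `^ (2 * q) / q).
  by rewrite divr_gt0// powR_gt0// invr_gt0 powR_gt0// divr_gt0.
by move=> n f; apply: tf_duality => // g gi gq; exact: tf_Lp_ge1.
Qed.

(** * The truncated kernel *)

(** Storage is 0-based while [minG] counts from 1, so vanishing at the indices below [n] means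
    [n < min y]. *)
Lemma minG_cyl n y : cyl n emptyG y <->
  ((if minG y is Some m then (n < m)%N else true) : bool).
Proof.
rewrite /minG; case: pselect => [H|H]; last first.
  split => // _ i _; apply/negP => yi; apply: H; by exists i.
case: ex_minnP => m ym mmin; rewrite ltnS; split => [h|nm i lin].
  by rewrite leqNgt; apply/negP => mn; move: ym; rewrite h.
apply/negP => yi; have := mmin i yi.
by rewrite leqNgt (leq_trans lin nm).
Qed.

Lemma cyl_addG n x z : cyl n emptyG (addG x z) <-> cyl n x z.
Proof.
rewrite /cyl /addG /emptyG; split => h i hi; have := h i hi => /=.
  by case: (x i); case: (z i).
by move=> ->; case: (x i).
Qed.

(** Difference of the convolution kernels of two consecutive averages. *)
Lemma kappaE n y : kappa R n.+1 y =
  2 ^+ n.+1 * \1_(cyl n.+1 emptyG) y - 2 ^+ n * \1_(cyl n emptyG) y.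
Proof.
have ind k : \1_(cyl k emptyG) y =
    ((if minG y is Some m then (k < m)%N else true) : bool)%:R :> R.
  rewrite indicE (_ : (y \in _) = if minG y is Some m then (k < m)%N else true)//.
  by apply/idP/idP => [/set_mem/minG_cyl|/minG_cyl/mem_set].
rewrite !ind /kappa; case: (minG y) => [m|]; last by rewrite !mulr1 exprS; lra.
have [_|_|->] := ltngtP n.+1 m.
- by rewrite !mulr1 exprS; lra.
- by rewrite !mulr0 subrr.
- by rewrite mulr0 mulr1 sub0r.
Qed.

Lemma indic_addG n x z :
  \1_(cyl n emptyG) (addG x z) = \1_(cyl n x) z :> R.
Proof.
rewrite !indicE (_ : (_ \in _) = (z \in cyl n x))//.
by apply/idP/idP => /set_mem/cyl_addG/mem_set.
Qed.

Lemma integ_indicM A (h : G -> R) : measurable A -> integ h ->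
  integ (fun z => \1_A z * h z).
Proof.
move=> mA ih; have h1 x : `|\1_A x : R| <= 1.
  by rewrite indicE; case: (_ \in _); rewrite ?normr1 ?normr0.
have mi : measurable_fun [set: G] (\1_A : G -> R) by exact: measurable_indic.
have := integ_mul_bounded ih mi h1.
by apply: eq_integrable => // x _ /=; rewrite mulrC.
Qed.

Lemma int_indicM A (h : G -> R) :
  \int[mu]_z (\1_A z * h z) = \int[mu]_(z in A) h z.
Proof.
rewrite [RHS]Rintegral_mkcond; apply: eq_Rintegral => z _.
by rewrite patchE indicE; case: ifP; rewrite ?mul1r ?mul0r.
Qed.

Lemma kappa_addG n x z (h : G -> R) : kappa R n (addG x z) * h z =
  if n is m.+1 then 2 ^+ n * (\1_(cyl n x) z * h z) -
                    2 ^+ m * (\1_(cyl m x) z * h z)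
  else h z.
Proof.
case: n => [|n]; first by rewrite /kappa mul1r.
by rewrite kappaE !indic_addG mulrBl !mulrA.
Qed.

Lemma integ_kappa n x (h : G -> R) : integ h ->
  integ (fun z => kappa R n (addG x z) * h z).
Proof.
move=> ih; apply: (eq_integrable measurableT
    (EFin \o fun z => if n is m.+1 then 2 ^+ n * (\1_(cyl n x) z * h z) -
                    2 ^+ m * (\1_(cyl m x) z * h z) else h z)).
  by move=> z _; rewrite /= kappa_addG.
by case: n => //= n; apply: integB; apply: integZ; exact: integ_indicM.
Qed.

Lemma int_kappa n x (h : G -> R) : integ h ->
  \int[mu]_z (kappa R n (addG x z) * h z) = dif n h x.
Proof.
move=> ih; under eq_Rintegral do rewrite kappa_addG.
case: n => [|n] /=; first by rewrite avg0.
rewrite RintegralB ?RintegralZl ?int_indicM//; try exact: integ_indicM.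
- by apply: integZ; exact: integ_indicM.
- by apply: integZ; exact: integ_indicM.
Qed.

Lemma convG_dif n h x : integ h -> convG mu (kappa R n) h x = dif n h x.
Proof.
move=> ih; rewrite -int_kappa//.
rewrite -(Rintegral_addG x (integ_kappa n x ih)).
by congr fine; apply: eq_integral => z _; rewrite addGK.
Qed.

(* The value of kappa_n on the cylinder [cyl N emptyG] for [n <= N]. *)
Definition wgt n : R := if n is m.+1 then 2 ^+ m else 1.

Definition trK N (f : G -> nat -> R) (x : G) : nat -> R := fun n =>
  if (n <= N)%N then tf f x n - wgt n * \int[mu]_(y in cyl N x) f y n else 0.

(** For [n > N] the kernel vanishes off the removed cylinder; for [n <= N] it is constant on it, so
    the removal subtracts a multiple of a plain integral. Translating by [x] moves the cylinder from
    the identity to [x]. *)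
Lemma truncK_trK f x r N : (forall k, integ (f^~ k)) ->
  ballG emptyG r = cyl N emptyG -> Defs.truncK mu f x r = trK N f x.
Proof.
move=> fi br; apply/funext => n; rewrite /Defs.truncK br.
pose psi z := (1 - \1_(cyl N x) z) * (kappa R n (addG x z) * f z n).
have kN z : cyl N emptyG z -> (n <= N)%N -> kappa R n z = wgt n.
  move=> zN nN; case: n nN {psi} => [|n] nN; rewrite /kappa /wgt//.
  have /minG_cyl := cyl_sub nN zN; by case: (minG z) => // m ->.
have kN0 z : ~ cyl N emptyG z -> (N < n)%N -> kappa R n z = 0.
  case: n {psi kN} => // n zN nN; rewrite kappaE !indicE !memNset ?mulr0 ?subrr//.
    by move=> h; apply: zN; exact: cyl_sub h.
  by move=> h; apply: zN; apply: cyl_sub h; exact: leqW.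
have psiE z : psi z = if (n <= N)%N then
    kappa R n (addG x z) * f z n - wgt n * (\1_(cyl N x) z * f z n) else 0.
  rewrite /psi -indic_addG indicE.
  have [zN|zN] := pselect (cyl N emptyG (addG x z)).
    rewrite mem_set// subrr mul0r mul1r; case: leqP => // nN.
    by rewrite kN// subrr.
  rewrite memNset// subr0 mul1r mul0r mulr0 subr0; case: leqP => // nN.
  by rewrite kN0// mul0r.
have ipsi : integ psi.
  apply: (eq_integrable measurableT (EFin \o fun z => if (n <= N)%N then
    kappa R n (addG x z) * f z n - wgt n * (\1_(cyl N x) z * f z n) else 0)).
    by move=> z _; rewrite /= psiE.
  case: (n <= N)%N; last by apply: (@integ_adapted 0).
  by apply: integB; [exact: integ_kappa|apply: integZ; exact: integ_indicM].
transitivity (\int[mu]_z psi z).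
  rewrite -(Rintegral_addG x ipsi).
  transitivity (\int[mu]_(y in ~` cyl N emptyG) (kappa R n y * f (addG x y) n)) => //.
  rewrite Rintegral_mkcond; apply: eq_Rintegral => z _.
  rewrite /psi addGK -indic_addG addGK patchE indicE.
  case: (boolP (z \in _)) => [/set_mem zN|/negP zN].
    by rewrite memNset// subr0 mul1r.
  rewrite mem_set ?subrr ?mul0r//; apply: contrapT => h; apply: zN.
  exact: mem_set.
under eq_Rintegral do rewrite psiE.
rewrite /trK; case: leqP => nN; last by rewrite Rint_cst.
rewrite RintegralB//; [|exact: integ_kappa|by apply: integZ; exact: integ_indicM].
by rewrite int_kappa// RintegralZl ?int_indicM//; exact: integ_indicM.
Qed.

Lemma ballG_pow N : ballG emptyG ((2 ^+ N)^-1 : R) = cyl N emptyG.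
Proof.
apply/seteqP; rewrite /ballG /dG; split => y /=; rewrite add0G.
  move=> h; apply/minG_cyl; move: h; case: (minG y) => // m.
  by rewrite ltf_pV2 ?posrE ?exprn_gt0// ltr_eXn2l// ltr1n.
move=> /minG_cyl; case: (minG y) => [m|_]; last by rewrite invr_gt0 exprn_gt0.
by rewrite ltf_pV2 ?posrE ?exprn_gt0// ltr_eXn2l// ltr1n.
Qed.

Lemma cvg_pow2 : (fun N : nat => (2 ^+ N)^-1 : R) @ \oo --> (0 : R).
Proof.
have -> : (fun N : nat => (2 ^+ N)^-1 : R) = geometric 1 2^-1.
  by apply/funext => N; rewrite /geometric /= mul1r exprVn.
by apply: cvg_geometric; rewrite ger0_norm// invf_lt1// ltr1n.
Qed.

(** Nonzero distances are powers 2^-m with m >= 1, so the least [N] with 2^-(N+1) < r works. The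
    limit in [r] thereby becomes a limit along cylinders. *)
Lemma ballG_cyl N0 (r : R) : 0 < r -> r < (2 ^+ N0)^-1 ->
  exists2 N, (N0 <= N)%N & ballG emptyG r = cyl N emptyG.
Proof.
move=> r0 rN0.
have exN : exists N, ((2 ^+ N.+1)^-1 < r :> R).
  have /cvgrPdist_lt/(_ r r0)[n _ hn] := cvg_pow2.
  by exists n; have := hn n.+1 (leqnSn n); rewrite /= sub0r normrN ger0_norm.
have [N hN minN] := ex_minnP exN; exists N.
  have := lt_trans hN rN0.
  by rewrite ltf_pV2 ?posrE ?exprn_gt0// ltr_eXn2l// ltr1n.
apply/seteqP; rewrite /ballG /dG; split => y /=; rewrite add0G.
  move=> h; apply/minG_cyl; move: h; case e : (minG y) => [m|//].
  have : (0 < m)%N by move: e; rewrite /minG; case: pselect => // H [<-].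
  by case: m {e} => // m _ /minN.
move=> /minG_cyl; case: (minG y) => [m|//] Nm; apply: le_lt_trans hN.
by rewrite lef_pV2 ?posrE ?exprn_gt0// ler_weXn2l// ler1n.
Qed.

Lemma cvg_int_cyl x (h : G -> R) : integ h ->
  (fun N => \int[mu]_(y in cyl N x) h y) @ \oo --> (0 : R).
Proof.
move=> ih; apply/cvgrPdist_lt => e e0.
have [d [d0 hd]] := integral_normr_continuous ih e0.
have /cvgrPdist_lt/(_ d d0)[N _ hN] := cvg_pow2.
exists N => // n /hN /=; rewrite !sub0r !normrN ger0_norm// => nd.
apply: le_lt_trans (hd (cyl n x) _ _) => //.
  by apply: le_normr_Rintegral => //; exact: integ_sub.
by rewrite mu_cyl lte_fin.
Qed.

Lemma wgt_gt0 n : 0 < wgt n.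
Proof. by case: n => [|n] /=; rewrite ?ltr01 ?exprn_gt0. Qed.

Lemma wgt_le n N : (n <= N)%N -> wgt n <= 2 ^+ N.
Proof.
case: n => [_|n nN] /=; first by rewrite exprn_ege1// ler1n.
by rewrite ler_weXn2l ?ler1n// ltnW.
Qed.

Lemma cvg_trK f x n : integ (f^~ n) ->
  (fun N => trK N f x n) @ \oo --> tf f x n.
Proof.
move=> ih; apply/cvgrPdist_lt => e e0; have w0 := wgt_gt0 n.
have ew : 0 < e / wgt n by rewrite divr_gt0.
have /cvgrPdist_lt/(_ _ ew)[N _ hN] := cvg_int_cyl x ih.
exists (maxn N n) => // m /=; rewrite geq_max => /andP[/hN /= h nm].
move: h; rewrite sub0r normrN ltr_pdivlMr// => h.
by rewrite /trK nm opprB addrCA subrr addr0 normrM (gtr0_norm w0) mulrC.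
Qed.

Lemma PVlim_cyl f x v : (forall k, integ (f^~ k)) -> PVlim mu f x v <->
  is_l2 v /\ (fun N => l2sq (fun n => trK N f x n - v n)) @ \oo --> 0%E.
Proof.
move=> fi; split => -[v2 h]; split => //.
  apply/ge0_cvge0P => [N|e e0]; first exact: l2sq_ge0.
  have e0' : (0 < e%:E)%E by rewrite lte_fin.
  have [d /= d0 hd] := h _ (open_ereal_lt' e0').
  have /cvgrPdist_lt/(_ d d0)[N _ hN] := cvg_pow2.
  exists N => n /hN /= nd.
  have := hd (2 ^+ n)^-1 nd; rewrite /= (truncK_trK _ fi (ballG_pow n)).
  by rewrite invr_gt0 exprn_gt0// => /(_ isT)/ltW.
move=> U /= U0; have [N _ hN] := h U U0.
exists (2 ^+ N)^-1; first by rewrite /= invr_gt0 exprn_gt0.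
move=> r /=; rewrite sub0r normrN => rN r0.
have [n Nn rn] := ballG_cyl r0 (le_lt_trans (ler_norm _) rN).
by rewrite (truncK_trK _ fi rn); exact: hN.
Qed.

Lemma PVlim_unique f x v : (forall k, integ (f^~ k)) ->
  PVlim mu f x v -> v = tf f x.
Proof.
move=> fi /PVlim_cyl => /(_ fi)[v2 h]; apply/funext => n.
have h1 : (fun N => trK N f x n) @ \oo --> v n.
  apply/cvgrPdist_le => e e0.
  have [N hN] := (ge0_cvge0P (fun N => l2sq_ge0 _)).1 h (e ^+ 2) (exprn_gt0 2 e0).
  exists N => // m /= /hN hm; rewrite distrC.
  have := le_trans (sqr_le_l2sq (fun n => trK m f x n - v n) n) hm.
  rewrite lee_fin -[_ ^+ 2](real_normK (num_real _)) ler_sqr// nnegrE ltW//.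
by rewrite -(cvg_lim _ h1)//; apply: cvg_lim => //; exact: cvg_trK.
Qed.

Definition ell (f : G -> nat -> R) N x : \bar R :=
  l2sq (fun n => trK N f x n - tf f x n).

(** A measurable description of the points where the principal value exists: the limit is fixed to
    [tf f x], and convergence to 0 of a nonnegative sequence is written with an upper limit. *)
Definition PVset (f : G -> nat -> R) : set G :=
  [set x | (l2sq (tf f x) < +oo)%E] `&`
  [set x | (limn_esup (fun N => ell f N x) <= 0)%E].

Lemma PVsetP f x : (forall k, integ (f^~ k)) ->
  PVset f x <-> PVlim mu f x (tf f x).
Proof.
move=> fi; rewrite (PVlim_cyl _ _ fi); split => -[h1 h2]; split => //.
  by apply: limn_esup_le_cvg => // n; exact: l2sq_ge0.
by rewrite /= (cvg_limn_einf_sup h2).2.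
Qed.

Lemma PVK_on f x : (forall k, integ (f^~ k)) -> PVset f x -> PVK mu f x = tf f x.
Proof.
move=> fi /(PVsetP _ fi) h; rewrite /PVK; case: pselect => [e|]; last first.
  by case; exists (tf f x).
by case: cid => v /= /(PVlim_unique fi).
Qed.

Lemma PVK_off f x : (forall k, integ (f^~ k)) ->
  ~ PVset f x -> PVK mu f x = fun=> 0.
Proof.
move=> fi h; rewrite /PVK; case: pselect => [e|//].
case: cid => v /= hv; exfalso; apply: h; apply/PVsetP => //.
by rewrite -(PVlim_unique fi hv).
Qed.

Lemma adapted_trK N f n : adapted (maxn N n) (fun x => trK N f x n).
Proof.
move=> x y xy; rewrite /trK; case: ifP => // nN.
rewrite (adapted_tf f (leq_maxr N n) xy).
by rewrite (cyl_eq (cyl_sub (leq_maxl N n) xy)).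
Qed.

Lemma measurable_tf f n : measurable_fun [set: G] (fun x => tf f x n).
Proof. exact: adapted_measurable (adapted_tf f (leqnn n)). Qed.

Lemma measurable_ell f N : measurable_fun [set: G] (ell f N).
Proof.
apply: measurable_l2sq => n; apply: measurable_funB.
  exact: adapted_measurable (@adapted_trK N f n).
exact: measurable_tf.
Qed.

Lemma measurable_PVset f : measurable (PVset f).
Proof.
apply: measurableI.
  rewrite -[X in measurable X]setTI; apply: emeasurable_fun_infty_o => //.
  by apply: measurable_l2sq => n; exact: measurable_tf.
rewrite -[X in measurable X]setTI; apply: emeasurable_fun_infty_c => //.
by apply: measurable_fun_limn_esup => N; exact: measurable_ell.
Qed.

Lemma measV_PVK f : (forall k, integ (f^~ k)) -> measV (PVK mu f).
Proof.
move=> fi n; have mE := measurable_PVset f.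
(* The default value 0 of [PVK] makes this identity hold at every point. *)
rewrite (_ : (fun x => PVK mu f x n) = fun x => \1_(PVset f) x * tf f x n).
  apply: measurable_funM; first exact: measurable_indic.
  exact: measurable_tf.
apply/funext => x; rewrite indicE; have [h|h] := pselect (PVset f x).
  by rewrite mem_set// mul1r PVK_on.
by rewrite memNset// mul0r PVK_off.
Qed.

(** * Almost everywhere convergence *)

Lemma mu_bigcup_le (F : nat -> set G) (c : \bar R) :
  (forall n, measurable (F n)) -> (forall n, F n `<=` F n.+1) ->
  (forall n, mu (F n) <= c)%E -> (mu (\bigcup_n F n) <= c)%E.
Proof.
move=> mF FS Fc.
have ndF : {homo F : n m / (n <= m)%N >-> (n <= m)%O}.
  by apply/nondecreasing_seqP => n; apply/subsetPset; exact: FS.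
have := nondecreasing_cvg_mu (mu := mu) mF (bigcup_measurable (fun n _ => mF n)) ndF.
move=> /cvg_lim <-//.
apply: lime_le; last by exists 0%N => // n _; exact: Fc.
apply: ereal_nondecreasing_is_cvgn => n m nm; apply: le_measure; rewrite ?inE//.
by apply/subsetPset; exact: ndF.
Qed.

Lemma normr_le_normV (v : nat -> R) k : (`|v k|%:E <= normV v)%E.
Proof.
rewrite normVE -sqrtr_sqr -powR12_sqrt ?sqr_ge0// -poweR_EFin.
by rewrite le_poweR ?lee_fin ?sqr_ge0// sqr_le_l2sq.
Qed.

Section L1.
Variable f : G -> nat -> R.
Hypothesis mf : measV f.
Hypothesis f1 : (\int[mu]_x normV (f x) < +oo)%E.

Let K := fine (\int[mu]_x normV (f x)).

Lemma integrable_normV : mu.-integrable setT (fun x => normV (f x)).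
Proof.
apply/integrableP; split; first exact: measurable_normV.
by under eq_integral do rewrite gee0_abs ?normV_ge0//.
Qed.

Lemma int_normVE : (\int[mu]_x normV (f x))%E = K%:E.
Proof. by rewrite fineK// ge0_fin_numE// integral_ge0// => x _; exact: normV_ge0. Qed.

Lemma L1_integ k : integ (f^~ k).
Proof.
apply: le_integrable integrable_normV => //; first by apply/measurable_EFinP; exact: mf.
move=> x _ /=; rewrite [leRHS]gee0_abs ?normV_ge0//; exact: normr_le_normV.
Qed.

Lemma int_nrm_le n : \int[mu]_x nrm (index_iota 0 n) (f x) <= K.
Proof.
rewrite -lee_fin -int_normVE /Rintegral fineK; last first.
  by apply: integrable_fin_num => //; exact: (integ_nrm _ L1_integ).
apply: ge0_le_integral => //.
- by move=> x _; rewrite lee_fin.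
- by apply/measurable_EFinP; exact: measurable_nrm.
- exact: measurable_normV.
- by move=> x _; exact: nrm_le_normV.
Qed.

Lemma weak_tf (l : R) : 0 < l ->
  (mu [set x | ((l ^+ 2)%:E < l2sq (tf f x))%E] <= (l^-1 * (2 * K))%:E)%E.
Proof.
move=> l0; rewrite l2sq_bigcup.
have mT n : measurable [set x | l ^+ 2 < sqn (seg n) (tf f x)].
  apply: (@adapted_measurable_set n) => x y xy.
  by rewrite (adapted_sqn_tf f xy).
apply: mu_bigcup_le => [//|n x /= /lt_le_trans|n].
  by apply; rewrite /sqn [leRHS]big_nat_recr//= lerDl sqr_ge0.
have mS : measurable [set x | l ^+ 2 <= sqf (seg n) f n x].
  apply: (@adapted_measurable_set n) => x y xy.
  by rewrite (adapted_sqf _ f xy).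
apply: (@le_trans _ _ (mu [set x | l ^+ 2 <= sqf (seg n) f n x])).
  apply: le_measure; rewrite ?inE//.
  by move=> x /= /ltW /le_trans; apply; exact: sqn_tf_le.
rewrite -[leLHS]fineK ?ge0_fin_numE ?fin_mu// lee_fin ler_pdivlMl//.
apply: le_trans (weak_type_sqf _ _ l0 L1_integ) _.
by rewrite ler_pM2l// int_nrm_le.
Qed.

Lemma K_ge0 : 0 <= K.
Proof. by apply: fine_ge0; apply: integral_ge0 => x _; exact: normV_ge0. Qed.

Lemma tf_l2_ae : mu [set x | l2sq (tf f x) = +oo%E] = 0%E.
Proof.
apply/eqP; rewrite eq_le measure_ge0 andbT; apply/lee_addgt0Pr => e e0.
(* The weak type bound 2K/l is then at most [e]; the summand 1 keeps [l] positive if [K = 0]. *)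
rewrite add0e; pose l := (2 * K + 1) / e.
have l0 : 0 < l by rewrite divr_gt0// ltr_wpDl// mulr_ge0// K_ge0.
apply: (@le_trans _ _ (mu [set x | ((l ^+ 2)%:E < l2sq (tf f x))%E])).
  have ml : measurable_fun [set: G] (fun x => l2sq (tf f x)).
    by apply: measurable_l2sq => n; exact: measurable_tf.
  apply: le_measure; rewrite ?inE.
  - rewrite -[X in measurable X]setTI; exact: (ml measurableT _ (emeasurable_set1 _)).
  - by rewrite -[X in measurable X]setTI; apply: emeasurable_fun_o_infty.
  - by move=> x /= ->; rewrite ltry.
apply: le_trans (weak_tf l0) _.
rewrite lee_fin /l invf_div mulrAC ler_pdivrMr ?ltr_wpDl ?mulr_ge0 ?K_ge0//.
by rewrite ler_wpM2l ?(ltW e0)// lerDl.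
Qed.

End L1.

Lemma submartingale_nrm s g m x : (forall k, integ (g^~ k)) ->
  nrm s (vavg m g x) <=
  (nrm s (vavg m.+1 g x) + nrm s (vavg m.+1 g (flip m x))) / 2.
Proof.
move=> gi; pose d k := vavg m.+1 g x k - vavg m g x k.
have e1 : vavg m.+1 g x = fun k => vavg m g x k + d k.
  by apply/funext => k; rewrite /d addrC subrK.
have e2 : vavg m.+1 g (flip m x) = fun k => vavg m g x k - d k.
  apply/funext => k; rewrite /d /vavg.
  have := avg_half m x (gi k); lra.
by rewrite e2 e1; have := nrm_mid s (vavg m g x) d; lra.
Qed.

(** A level set of the martingale maximal function. Using one [N] for both the coordinates and the
    time horizon makes the union increasing and each member a finite union of cylinders. *)
Definition maxset (g : G -> nat -> R) (l : R) : set G :=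
  \bigcup_N [set x | has (fun i => l <= nrm (seg N) (vavg i g x)) (iota 0 N.+1)].

Lemma measurable_maxN g l N : measurable
  [set x | has (fun i => l <= nrm (seg N) (vavg i g x)) (iota 0 N.+1)].
Proof.
apply: (@adapted_measurable_set N) => x y xy; apply: eq_in_has => i.
rewrite mem_iota add0n => /andP[_ iN].
by rewrite (adaptedW _ (@adapted_vavg i g) xy).
Qed.

Lemma measurable_maxset g l : measurable (maxset g l).
Proof. by apply: bigcup_measurable => N _; exact: measurable_maxN. Qed.

Lemma maxset_le g l : 0 < l -> measV g -> (\int[mu]_x normV (g x) < +oo)%E ->
  (mu (maxset g l) <= (l^-1)%:E * \int[mu]_x normV (g x))%E.
Proof.
move=> l0 mg g1; have gi := L1_integ mg g1; apply: mu_bigcup_le => N.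
- exact: measurable_maxN.
- move=> x; rewrite /mkset => /hasP[i]; rewrite mem_iota add0n => /andP[_ iN] hi.
  apply/hasP; exists i; first by rewrite mem_iota add0n (leq_trans iN).
  apply: le_trans hi _; rewrite ler_sqrt// /sqn [leRHS]big_nat_recr//= lerDl.
  exact: sqr_ge0.
rewrite int_normVE// -EFinM -[leLHS]fineK ?ge0_fin_numE ?fin_mu//; last first.
  exact: measurable_maxN.
rewrite lee_fin ler_pdivlMl//.
pose X i x := nrm (seg N) (vavg i g x).
have aX m : adapted m (X m) by move=> x y xy; rewrite /X (adapted_vavg g xy).
apply: le_trans (maximal_ineq N l aX _ _) _ => [m x|m x|].
- exact: nrm_ge0.
- exact: submartingale_nrm.
apply: le_trans (int_nrm_le mg g1 N.+1).
rewrite -(int_avg N (integ_nrm (seg N) gi)); apply: le_Rintegral => //.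
- exact: integ_adapted (aX N).
- exact: integ_avg.
by move=> x _; exact: nrm_vavg.
Qed.

Lemma measV_tail M (f : G -> nat -> R) : measV f -> measV (fun x => tailV M (f x)).
Proof.
move=> mf n; rewrite (_ : (fun x => tailV M (f x) n) =
  fun x => if (M <= n)%N then f x n else 0)//.
by case: (M <= n)%N => //; exact: mf.
Qed.

Lemma l2sq_tail_le M (v : nat -> R) : (l2sq (tailV M v) <= l2sq v)%E.
Proof.
apply: le_l2sq => k; rewrite /tailV; case: ifP => // _.
by rewrite expr0n sqr_ge0.
Qed.

Lemma normV_tail_le M (v : nat -> R) : (normV (tailV M v) <= normV v)%E.
Proof. by rewrite !normVE le_poweR ?l2sq_ge0 ?l2sq_tail_le. Qed.

Lemma vavg_tail N M f x n :
  vavg N (fun y => tailV M (f y)) x n = if (M <= n)%N then vavg N f x n else 0.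
Proof. by rewrite /vavg /tailV; case: ifP => // _; exact: avg_cst. Qed.

Lemma sqn_wgt_cvg f x M (e : R) : (forall k, integ (f^~ k)) -> 0 < e ->
  exists N0, forall N, (N0 <= N)%N -> sqn (index_iota 0 M)
    (fun n => wgt n * \int[mu]_(y in cyl N x) f y n) <= e.
Proof.
move=> fi; elim: M e => [|M ih] e e0.
  by exists 0%N => N _; rewrite /sqn big_nil ltW.
have e2 : 0 < e / 2 by rewrite divr_gt0.
have [N1 h1] := ih _ e2.
have d0 : 0 < Num.sqrt (e / 2) / wgt M by rewrite divr_gt0 ?sqrtr_gt0 ?wgt_gt0.
have /cvgrPdist_lt/(_ _ d0)[N2 _ h2] := cvg_int_cyl x (fi M).
exists (maxn N1 N2) => N; rewrite geq_max => /andP[/h1 hN1 /h2 /=].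
rewrite sub0r normrN ltr_pdivlMr ?wgt_gt0// => hN2.
rewrite /sqn big_nat_recr//= [leRHS]splitr lerD//.
rewrite -[leLHS](real_normK (num_real _)) normrM (gtr0_norm (wgt_gt0 M)) mulrC.
by apply: sqr_le_of_sqrt; [rewrite mulr_ge0// ltW// wgt_gt0|exact: ltW|exact: ltW].
Qed.

Section L1_ae.
Variable f : G -> nat -> R.
Hypothesis mf : measV f.
Hypothesis f1 : (\int[mu]_x normV (f x) < +oo)%E.

Let fi := L1_integ mf f1.

(** Points where no tail of [f] has a maximal function below [l]. The maximal inequality bounds the
    measure by [l^-1] times the L^1 norm of every tail, hence by 0. *)
Let bad (l : R) : set G :=
  \bigcap_M maxset (fun x => tailV M (f x)) l.

Lemma int_tail_lty M : (\int[mu]_x normV (tailV M (f x)) < +oo)%E.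
Proof.
apply: le_lt_trans f1; apply: ge0_le_integral => //.
- by move=> x _; exact: normV_ge0.
- by apply: measurable_normV; exact: measV_tail.
- exact: measurable_normV.
- by move=> x _; exact: normV_tail_le.
Qed.

Lemma int_tail_cvg : (fun M => \int[mu]_x normV (tailV M (f x)))%E @ \oo --> 0%E.
Proof.
have mt M := measurable_normV (measV_tail M mf).
have h1 : {ae mu, forall x, [set: G] x ->
    (fun M => normV (tailV M (f x))) @ \oo --> cst 0%E x}.
  have := integrable_ae measurableT (integrable_normV mf f1).
  apply: filterS => x /(_ I) fx _; apply: normV_tail_cvg.
  apply: (@lty_poweRy _ _ 2^-1); first by rewrite gt_eqF.
  by rewrite -normVE ltey_eq fx.
have h2 : {ae mu, forall x M, [set: G] x ->
    (`|normV (tailV M (f x))| <= normV (f x))%E}.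
  by apply: aeW => x M _; rewrite gee0_abs ?normV_ge0 ?normV_tail_le.
have [_ _] := dominated_convergence measurableT mt (measurable_cst _) h1
  (integrable_normV mf f1) h2.
by rewrite integral0.
Qed.

Lemma measurable_bad l : measurable (bad l).
Proof. by apply: bigcapT_measurable => M; exact: measurable_maxset. Qed.

Lemma mu_bad l : 0 < l -> mu (bad l) = 0%E.
Proof.
move=> l0; apply/eqP; rewrite eq_le measure_ge0 andbT.
apply/lee_addgt0Pr => e e0; rewrite add0e.
have le0 : 0 < l * e by rewrite mulr_gt0.
have [M hM] := (ge0_cvge0P (fun M => integral_ge0 _ (fun x _ => normV_ge0 _))).1
  int_tail_cvg _ le0.
have := maxset_le l0 (measV_tail M mf) (int_tail_lty M).
move=> h; apply: le_trans (le_trans _ h) _.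
  apply: le_measure; rewrite ?inE; first exact: measurable_bad.
    exact: measurable_maxset.
  by move=> x; apply.
apply: le_trans (lee_wpmul2l _ (hM M (leqnn M))) _.
  by rewrite lee_fin invr_ge0 ltW.
by rewrite -EFinM mulKf// gt_eqF.
Qed.

Lemma ell_split N x : ell f N x =
  ((sqn (seg N) (fun n => wgt n * \int[mu]_(y in cyl N x) f y n))%:E +
   l2sq (tailV N.+1 (tf f x)))%E.
Proof.
rewrite {1}/ell {1}/l2sq (nneseries_split 0 N.+1); last first.
  by move=> k _; rewrite lee_fin sqr_ge0.
rewrite add0n sqn_sumE l2sq_tail; congr (_ + _)%E.
  apply: eq_big_nat => k /andP[_]; rewrite ltnS => kN; congr EFin.
  by rewrite /trK kN addrAC subrr sub0r sqrrN.
rewrite eseries_cond [RHS]eseries_cond; apply: eq_eseriesr => k /= Nk.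
by rewrite /trK leqNgt Nk sub0r sqrrN.
Qed.

Lemma PVset_good x : (l2sq (tf f x) < +oo)%E ->
  (forall j, ~ bad (j.+1%:R^-1) x) -> PVset f x.
Proof.
move=> x2 xb; split => //=.
suff h : (fun N => ell f N x) @ \oo --> 0%E by rewrite (cvg_limn_einf_sup h).2.
apply/ge0_cvge0P => [N|e e0]; first exact: l2sq_ge0.
have e3 : 0 < e / 3 by rewrite divr_gt0.
have [j hj] : exists j, (j.+1%:R^-1 : R) ^+ 2 <= e / 3.
  have /cvgrPdist_lt/(_ _ (_ : 0 < Num.sqrt (e / 3)))[|j _ hj] := @cvg_harmonic R.
    by rewrite sqrtr_gt0.
  exists j; have := hj j (leqnn j); rewrite /= sub0r normrN ger0_norm ?invr_ge0// => h.
  by apply: sqr_le_of_sqrt; rewrite ?invr_ge0 ?(ltW e3) ?(ltW h).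
set l := (j.+1%:R^-1 : R) in hj.
have [M hM] : exists M, ~ maxset (fun x => tailV M (f x)) l x.
  by apply: contrapT => /forallNP h; apply: (xb j) => M _; apply: contrapT.
have [N1 h1] := sqn_wgt_cvg x M fi e3.
have [N2 h2] := (ge0_cvge0P (fun N => l2sq_ge0 _)).1 (l2sq_tail_cvg x2) _ e3.
exists (maxn M (maxn N1 N2)) => N; rewrite !geq_max => /and3P[MN /h1 hN1 N2N].
(* One third for each block of coordinates: below [M] (shrinking cylinders), from [M] to [N]
   (maximal function of the tail of [f]), beyond [N] (tail of [tf f x]). *)
rewrite ell_split (_ : e = (e / 3 + e / 3) + e / 3); last by field.
rewrite EFinD leeD ?h2 ?(leqW N2N)// lee_fin.
rewrite /sqn (@big_cat_nat _ _ _ M) ?(leqW MN)//= lerD//.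
apply: le_trans hj.
have xN : nrm (seg N) (vavg N (fun y => tailV M (f y)) x) < l.
  rewrite ltNge; apply/negP => h; apply: hM; exists N => //; rewrite /mkset.
  by apply/hasP; exists N => //; rewrite mem_iota add0n ltnS leqnn.
apply: (@le_trans _ _ (sqn (seg N) (vavg N (fun y => tailV M (f y)) x))); last first.
  rewrite -nrm_sqr ler_sqr ?nnegrE ?(ltW xN)//.
  exact: le_trans (ltW xN).
rewrite /sqn [leRHS](@big_cat_nat _ _ _ M) ?(leqW MN)//= -[leLHS]add0r lerD//.
  by apply: sumr_ge0 => k _; exact: sqr_ge0.
(* Since [wgt k <= 2 ^+ N], each weighted integral is at most |E_N f_k| in absolute value. *)
rewrite !big_nat; apply: ler_sum => k /andP[Mk]; rewrite ltnS => kN.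
rewrite vavg_tail Mk /vavg /avg -[leLHS](real_normK (num_real _)).
rewrite -[leRHS](real_normK (num_real _)) ler_sqr ?nnegrE// !normrM ler_wpM2r//.
by rewrite !ger0_norm ?exprn_ge0 ?(ltW (wgt_gt0 k))// wgt_le.
Qed.

Lemma PVset_ae : mu.-negligible (~` PVset f).
Proof.
apply: (@negligibleS _ _ _ mu
  ([set x | l2sq (tf f x) = +oo%E] `|` \bigcup_j bad (j.+1%:R^-1))).
  move=> x nx; apply: contrapT => /not_orP[h1 h2]; apply: nx.
  apply: PVset_good; first by rewrite ltey; apply/eqP.
  by move=> j hj; apply: h2; exists j.
apply: negligibleU.
  apply/negligibleP; last exact: tf_l2_ae.
  have ml : measurable_fun [set: G] (fun x => l2sq (tf f x)).
    by apply: measurable_l2sq => n; exact: measurable_tf.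
  rewrite -[X in measurable X]setTI; exact: (ml measurableT _ (emeasurable_set1 _)).
apply: negligible_bigcup => j; apply/negligibleP; first exact: measurable_bad.
by apply: mu_bad; rewrite invr_gt0.
Qed.

End L1_ae.

(** * Boundedness and orthogonality *)

Lemma cvgn_einf_esup (u : nat -> \bar R) :
  (limn_esup u <= limn_einf u)%E -> u @ \oo --> limn_esup u.
Proof.
move=> h; have e : limn_einf u = limn_esup u.
  by apply/eqP; rewrite eq_le limn_einf_sup.
apply: (@squeeze_cvge _ _ _ _ (einfs u) _ (esups u)).
- near=> n; apply/andP; split.
    by apply: ereal_inf_lbound; exists n => /=.
  by apply: ereal_sup_ubound; exists n => /=.
- by rewrite -e limn_einf_lim; exact: is_cvg_einfs.
- by rewrite limn_esup_lim; exact: is_cvg_esups.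
Unshelve. all: by end_near. Qed.

(* [limn] of a divergent sequence is the junk value [point], so the limit is
   measurable without assuming convergence anywhere. *)
Lemma measurable_limn (u : nat -> G -> \bar R) :
  (forall n, measurable_fun [set: G] (u n)) ->
  measurable_fun [set: G] (fun x => limn (u^~ x)).
Proof.
move=> mu_; have ms := measurable_fun_limn_esup mu_.
have mi : measurable_fun [set: G] (fun x => limn_einf (u^~ x)).
  rewrite (_ : (fun x => _) = fun x => (- limn_esup (fun n => (- u n x)%E))%E).
    apply: measurableT_comp => //; apply: measurable_fun_limn_esup => n.
    exact: measurableT_comp.
  by apply/funext => x; rewrite (limn_esupN (u^~ x)) oppeK.
rewrite (_ : (fun x => limn (u^~ x)) = fun x =>
    if (limn_esup (u^~ x) <= limn_einf (u^~ x))%E then limn_esup (u^~ x)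
    else point).
  apply: measurable_fun_ifT => //; exact: measurable_fun_lee.
apply/funext => x; case: ifPn => h; first exact/cvg_lim/cvgn_einf_esup.
apply: dvgP => cu; move/negP : h; apply.
by rewrite is_cvg_limn_esupE// is_cvg_limn_einfE.
Qed.

(** This embeds L^p into L^1 on the probability space [G]. *)
Lemma le_1_poweR (x : \bar R) (p : R) : 1 <= p -> (0 <= x)%E ->
  (x <= 1 + x `^ p)%E.
Proof.
move=> p1; case: x => [r| |]// r0; last first.
  by rewrite poweRyr ?gt_eqF// (lt_le_trans _ p1).
rewrite poweR_EFin -EFinD !lee_fin in r0 *.
have := powR_tangent p1 r0 ler01; rewrite !powR1 mulr1.
have := powR_ge0 r p; clear -p1 r0; have [r1|r1] := leP 1 r; nra.
Qed.

Section Lp.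
Variables (p : R) (f : G -> nat -> R).
Hypothesis p1 : 1 <= p.
Hypothesis fp : LpV mu p f.

Lemma LpV_int : (\int[mu]_x (normV (f x) `^ p) < +oo)%E.
Proof.
case: fp => _; apply: lty_poweRy; rewrite invr_eq0 gt_eqF//.
exact: lt_le_trans p1.
Qed.

Lemma measurable_normVp : measurable_fun [set: G] (fun x => normV (f x) `^ p)%E.
Proof.
case: fp => mf _.
exact: (measurableT_comp (measurable_poweR p) (measurable_normV mf)).
Qed.

Lemma LpV_L1 : (\int[mu]_x normV (f x) < +oo)%E.
Proof.
have [mf _] := fp.
apply: (@le_lt_trans _ _ (\int[mu]_x (1 + normV (f x) `^ p)))%E.
  apply: ge0_le_integral => //.
  - by move=> x _; exact: normV_ge0.
  - exact: measurable_normV.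
  - by apply: emeasurable_funD => //; exact: measurable_normVp.
  - by move=> x _; exact: le_1_poweR (normV_ge0 _).
rewrite ge0_integralD//.
- by rewrite integral_cst// mu_prob mule1 lte_add_pinfty ?ltry// LpV_int.
- by move=> x _; exact: poweR_ge0.
- exact: measurable_normVp.
Qed.

Lemma LpV_integ k : integ (f^~ k).
Proof. by case: fp => mf _; exact: L1_integ LpV_L1 k. Qed.

Lemma sqn_powR_le n x :
  ((sqn (index_iota 0 n) (f x) `^ (p / 2))%:E <= normV (f x) `^ p)%E.
Proof.
rewrite normV_poweR -poweR_EFin le_poweR ?lee_fin ?sqn_le_l2sq//.
by rewrite divr_ge0// (le_trans _ p1).
Qed.

Lemma LpV_integ_sqn n : integ (fun x => sqn (index_iota 0 n) (f x) `^ (p / 2)).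
Proof.
have [mf _] := fp.
have h : mu.-integrable setT (fun x => normV (f x) `^ p)%E.
  apply/integrableP; split; first exact: measurable_normVp.
  by under eq_integral do rewrite gee0_abs ?poweR_ge0//; exact: LpV_int.
apply: le_integrable h => //.
  apply/measurable_EFinP.
  exact: (measurableT_comp (measurable_powR (p / 2)) (measurable_sqn _ mf)).
move=> x _ /=; rewrite ger0_norm ?powR_ge0// [leRHS]gee0_abs ?poweR_ge0//.
exact: sqn_powR_le.
Qed.

Lemma int_sqn_le n :
  ((\int[mu]_x (sqn (index_iota 0 n) (f x) `^ (p / 2)))%:E <=
   \int[mu]_x (normV (f x) `^ p))%E.
Proof.
have [mf _] := fp; rewrite /Rintegral fineK; last first.
  by apply: integrable_fin_num => //; exact: LpV_integ_sqn.
apply: ge0_le_integral => //.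
- by move=> x _; rewrite lee_fin powR_ge0.
- by have /measurable_int := LpV_integ_sqn n.
- exact: measurable_normVp.
- by move=> x _; exact: sqn_powR_le.
Qed.

End Lp.

Lemma normV_PVK_le f x : (forall k, integ (f^~ k)) ->
  (l2sq (PVK mu f x) <= l2sq (tf f x))%E.
Proof.
move=> fi; have [h|h] := pselect (PVset f x); first by rewrite PVK_on.
by rewrite PVK_off//; apply: le_l2sq => k; rewrite expr0n sqr_ge0.
Qed.

Lemma int_tf_Lp p : 1 < p -> exists2 C : R, 0 < C & forall f, LpV mu p f ->
  (\int[mu]_x (normV (tf f x) `^ p) <=
   C%:E * \int[mu]_x (normV (f x) `^ p))%E.
Proof.
move=> p1; have p1' := ltW p1; have p0 : 0 < p by exact: lt_trans p1.
have [|C C0 hC] := @tf_Lp (p / 2); first by clear -p1; lra.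
exists C => // f fp; have fi := LpV_integ p1' fp.
pose g n x : \bar R := (sqn (seg n) (tf f x) `^ (p / 2))%:E.
have ag n : adapted n (g n) by move=> x y xy; rewrite /g (adapted_sqn_tf f xy).
have mg n : measurable_fun [set: G] (g n) by exact: adapted_measurable (ag n).
have g0 n x : [set: G] x -> (0 <= g n x)%E by rewrite lee_fin powR_ge0.
have q0 : 0 <= p / 2 by rewrite divr_ge0// ltW.
have ndg x : [set: G] x -> {homo g^~ x : n m / (n <= m)%N >-> (n <= m)%E}.
  move=> _; apply/nondecreasing_seqP => n; rewrite lee_fin.
  apply: ge0_ler_powR; rewrite ?nnegrE//.
  by rewrite /sqn [leRHS]big_nat_recr//= lerDl sqr_ge0.
have cvg_g := cvg_monotone_convergence (mu := mu) measurableT mg g0 ndg.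
apply: (@le_trans _ _ (\int[mu]_x limn (g^~ x)))%E.
  apply: ge0_le_integral => //.
  - by move=> x _; exact: poweR_ge0.
  - apply: (measurableT_comp (measurable_poweR p)).
    by apply: measurable_normV => n; exact: measurable_tf.
  - exact: measurable_limn.
  move=> x _; rewrite normV_poweR.
  have cg : cvgn (g^~ x) by exact: ereal_nondecreasing_is_cvgn (ndg x I).
  have gl n : (g n x <= limn (g^~ x))%E.
    by apply: lime_ge => //; exists n => // m nm; exact: ndg.
  have l0 : (0 <= limn (g^~ x))%E by apply: le_trans (gl 0%N); exact: g0.
  (* With the exponent [p / 2] outermost, it suffices to bound [l2sq], hence each partial sum, by
     the limit raised to [(p / 2)^-1]. *)
  have -> : limn (g^~ x) = ((limn (g^~ x) `^ (p / 2)^-1) `^ (p / 2))%E.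
    by rewrite -poweRrM mulVf ?poweRe1// gt_eqF// divr_gt0.
  apply: le_poweR => //; first exact: l2sq_ge0.
  apply: l2sq_le => n.
  have -> : (sqn (seg n) (tf f x))%:E = (g n x `^ (p / 2)^-1)%E.
    by rewrite /g poweR_EFin -powRrM mulfV ?powRr1// gt_eqF// divr_gt0.
  by apply: le_poweR; [rewrite invr_ge0|exact: g0|exact: gl].
rewrite -(cvg_lim _ cvg_g)//; apply: lime_le.
  by apply/cvg_ex; eexists; exact: cvg_g.
exists 0%N => // n _ /=.
have ig : integ (fun x => sqn (seg n) (tf f x) `^ (p / 2)).
  by apply: (@integ_adapted n) => x y xy; rewrite (adapted_sqn_tf f xy).
have := hC n f fi (LpV_integ_sqn p1' fp n.+1).
rewrite -lee_fin {1}/Rintegral fineK; last exact: integrable_fin_num.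
move=> /le_trans; apply; rewrite EFinM lee_wpmul2l ?lee_fin ?(ltW C0)//.
exact: int_sqn_le.
Qed.

Lemma PVK_Lp p : 1 < p -> exists C : R, 0 < C /\ forall f, LpV mu p f ->
  LpV mu p (PVK mu f) /\ (LpnormV mu p (PVK mu f) <= C%:E * LpnormV mu p f)%E.
Proof.
move=> p1; have [C C0 hC] := int_tf_Lp p1.
have p1' := ltW p1; have p0 : 0 < p by exact: lt_trans p1.
exists (C `^ p^-1); split => [|f fp]; first exact: powR_gt0.
have fi := LpV_integ p1' fp; have mP := measV_PVK fi.
have h : (LpnormV mu p (PVK mu f) <= (C `^ p^-1)%:E * LpnormV mu p f)%E.
  rewrite /LpnormV -poweR_EFin -poweRM ?lee_fin ?(ltW C0)//; last first.
    by apply: integral_ge0 => x _; exact: poweR_ge0.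
  apply: le_poweR; rewrite ?invr_ge0 ?(ltW p0)//.
    by apply: integral_ge0 => x _; exact: poweR_ge0.
  apply: le_trans (hC f fp); apply: ge0_le_integral => //.
  - by move=> x _; exact: poweR_ge0.
  - exact: (measurableT_comp (measurable_poweR p) (measurable_normV mP)).
  - apply: (measurableT_comp (measurable_poweR p)).
    by apply: measurable_normV => n; exact: measurable_tf.
  - move=> x _; rewrite !normV_poweR le_poweR ?l2sq_ge0 ?normV_PVK_le//.
    by rewrite divr_ge0// ltW.
split => //; split => //; apply: le_lt_trans h _.
case: fp => _ fp; rewrite lte_mul_pinfty ?lee_fin ?powR_ge0//.
Qed.

Lemma PVexists_ae f : measV f -> (\int[mu]_x normV (f x) < +oo)%E ->
  {ae mu, forall x, PVexists mu f x}.
Proof.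
move=> mf f1; have fi := L1_integ mf f1.
apply: (negligibleS _ (PVset_ae mf f1)) => x h /PVsetP => /(_ fi) hx.
by apply: h; exists (tf f x).
Qed.

Lemma weak_PVK f : LpV mu 1 f -> {ae mu, forall x, PVexists mu f x} /\
  measV (PVK mu f) /\ (weakL1V mu (PVK mu f) <= 2%:E * LpnormV mu 1 f)%E.
Proof.
move=> fp; have [mf _] := fp; have f1 := LpV_L1 (lexx 1) fp.
have fi := L1_integ mf f1; have mP := measV_PVK fi.
split; first exact: PVexists_ae; split => //.
have -> : LpnormV mu 1 f = (\int[mu]_x normV (f x))%E.
  rewrite /LpnormV invr1 poweRe1; last by apply: integral_ge0 => x _; exact: poweR_ge0.
  by apply: eq_integral => x _; rewrite poweRe1// normV_ge0.
apply: ge_ereal_sup => _ [l /= l0 <-].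
rewrite int_normVE// -EFinM.
apply: (@le_trans _ _ (l%:E * (l^-1 * (2 * fine (\int[mu]_x normV (f x))%E))%:E)%E).
  rewrite lee_wpmul2l ?lee_fin ?(ltW l0)//; apply: le_trans (weak_tf mf f1 l0).
  apply: le_measure; rewrite ?inE.
  - rewrite -[X in measurable X]setTI; apply: emeasurable_fun_o_infty => //.
    exact: measurable_normV.
  - rewrite -[X in measurable X]setTI; apply: emeasurable_fun_o_infty => //.
    by apply: measurable_l2sq => n; exact: measurable_tf.
  - by move=> x /=; rewrite normV_lt// => /lt_le_trans; apply; exact: normV_PVK_le.
by rewrite -EFinM mulVKf// gt_eqF.
Qed.

Lemma avg_ae n (h k : G -> R) x : measurable_fun [set: G] h ->
  measurable_fun [set: G] k -> {ae mu, forall y, h y = k y} ->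
  avg n h x = avg n k x.
Proof.
move=> mh mk hk; rewrite /avg; congr (_ * fine _); apply: ae_eq_integral => //.
- by apply/measurable_EFinP; exact: measurable_funTS.
- by apply/measurable_EFinP; exact: measurable_funTS.
- by move: hk; apply: filterS => y /= ->.
Qed.

Lemma dif_ae n (h k : G -> R) x : measurable_fun [set: G] h ->
  measurable_fun [set: G] k -> {ae mu, forall y, h y = k y} ->
  dif n h x = dif n k x.
Proof.
by move=> mh mk hk; case: n => [|n] /=; rewrite !(avg_ae _ _ mh mk hk).
Qed.

Lemma PVK_ae f n : measV f -> (\int[mu]_x normV (f x) < +oo)%E ->
  {ae mu, forall x, PVK mu f x n = dif n (f^~ n) x}.
Proof.
move=> mf f1; have fi := L1_integ mf f1.
apply: (negligibleS _ (PVset_ae mf f1)) => x h hx; apply: h.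
by rewrite /= PVK_on.
Qed.

Lemma PVK_H2 f : LpV mu 2 f -> H2delta mu (PVK mu f).
Proof.
move=> f2; have [mf _] := f2; have f1 := LpV_L1 (ltW (ltr1n R 2)) f2.
have [C [_ /(_ f f2)[P2 _]]] := PVK_Lp (ltr1n R 2).
split=> // n; have Pi := LpV_integ (ltW (ltr1n R 2)) P2 n.
have := PVK_ae n mf f1; apply: filterS => x Px.
rewrite convG_dif// (dif_ae _ _ _ _ (PVK_ae n mf f1)).
- by rewrite dif_idem ?Px//; exact: L1_integ.
- exact: integ_meas.
- exact: integ_meas (integ_dif _ _).
Qed.

Lemma int_l2sq_lty f : LpV mu 2 f -> (\int[mu]_x l2sq (f x) < +oo)%E.
Proof.
move=> f2; have := LpV_int (ltW (ltr1n R 2)) f2.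
by under eq_integral do rewrite normV_poweR divff// poweRe1 ?l2sq_ge0//.
Qed.

Lemma integrable_l2sq f : LpV mu 2 f ->
  mu.-integrable setT (fun x => l2sq (f x)).
Proof.
move=> f2; apply/integrableP; split; first by apply: measurable_l2sq; case: f2.
by under eq_integral do rewrite gee0_abs ?l2sq_ge0//; exact: int_l2sq_lty.
Qed.

(** Delta_n is self-adjoint and idempotent, so the residual of [f] is orthogonal to its range.
    Replacing [g] by the bounded function [dif n g] makes the products integrable. *)
Lemma int_component_eq0 (f g h : G -> R) n :
  integ f -> integ g -> measurable_fun [set: G] h ->
  {ae mu, forall x, h x = dif n f x} ->
  {ae mu, forall x, dif n g x = g x} ->
  (\int[mu]_x ((f x - h x) * g x)%:E = 0)%E.
Proof.
move=> fi gi mh hf hg; have mg := integ_meas gi; have mf := integ_meas fi.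
have mdf := integ_meas (integ_dif n f).
have mdg := integ_meas (integ_dif n g).
have [M _ hM] := adapted_bounded (@adapted_dif n g).
have i1 := integ_mul_bounded fi mdg hM.
have i2 := integ_mul_bounded (integ_dif n f) mdg hM.
have e0 : \int[mu]_x (f x * dif n g x - dif n f x * dif n g x) = 0.
  rewrite RintegralB// (dif_sym n fi mdg hM); apply/eqP; rewrite subr_eq0.
  apply/eqP; apply: eq_Rintegral => x _; by rewrite dif_idem.
rewrite (@ae_eq_integral _ _ _ mu setT
  (fun x => (f x * dif n g x - dif n f x * dif n g x)%:E))//.
- have := integrable_fin_num measurableT (integB i1 i2).
  by move=> /fineK <-; rewrite -/(Rintegral _ _ _) e0.
- apply/measurable_EFinP; apply: measurable_funM => //.
  exact: measurable_funB.
- by case/integrableP : (integB i1 i2).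
- by move: hf hg; apply: filterS2 => x -> <- _; rewrite mulrBl.
Qed.

(** Source of the integrable majorant that lets sum and integral be exchanged in the inner
    product. *)
Lemma sum_mul_le (a b c : nat -> R) N :
  \sum_(0 <= k < N) `|(a k - b k) * c k| <=
  sqn (index_iota 0 N) a + sqn (index_iota 0 N) b + sqn (index_iota 0 N) c.
Proof.
rewrite /sqn -!big_split /=; apply: ler_sum => k _.
move: (a k) (b k) (c k) => {}a {}b {}c.
have := sqr_ge0 a; have := sqr_ge0 b.
have := sqr_ge0 (a - c); have := sqr_ge0 (a + c).
have := sqr_ge0 (b - c); have := sqr_ge0 (b + c).
by rewrite ler_norml => *; apply/andP; split; lra.
Qed.

Lemma PVK_inner f g : LpV mu 2 f -> H2delta mu g ->
  innerV mu (fun x n => f x n - PVK mu f x n) g = 0%E.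
Proof.
move=> f2 [g2 hg]; have [mf _] := f2; have [mg _] := g2.
have [P2 _] := PVK_H2 f2; have [mP _] := P2.
have l12 := ltW (ltr1n R 2); have f1 := LpV_L1 l12 f2.
have fi := LpV_integ l12 f2; have gi := LpV_integ l12 g2.
pose F n x := (f x n - PVK mu f x n) * g x n.
pose D x := (l2sq (f x) + l2sq (PVK mu f x) + l2sq (g x))%E.
have iD : mu.-integrable setT D.
  by apply: integrableD => //; [apply: integrableD => //|]; exact: integrable_l2sq.
have D0 x : (0 <= D x)%E by rewrite !adde_ge0 ?l2sq_ge0.
have FD N x : ((\sum_(0 <= k < N) `|F k x|)%:E <= D x)%E.
  apply: le_trans (_ : (_ <= (sqn (index_iota 0 N) (f x) +
    sqn (index_iota 0 N) (PVK mu f x) + sqn (index_iota 0 N) (g x))%:E)%E) _.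
    by rewrite lee_fin; exact: sum_mul_le.
  by rewrite !EFinD !leeD ?sqn_le_l2sq.
have mF n : measurable_fun [set: G] (F n).
  by apply: measurable_funM; [apply: measurable_funB|]; [exact: mf|exact: mP|exact: mg].
pose S N x : \bar R := (\sum_(0 <= k < N) (F k x)%:E)%E.
have SE N x : S N x = (\sum_(0 <= k < N) F k x)%:E by rewrite /S sumEFin.
have mS N : measurable_fun [set: G] (S N).
  by apply: emeasurable_sum => k; apply/measurable_EFinP; exact: mF.
have SD N x : (`|S N x| <= D x)%E.
  by apply: le_trans (FD N x); rewrite SE lee_fin ler_norm_sum.
have iS N : mu.-integrable setT (S N).
  by apply: le_integrable iD => // x _; rewrite [leRHS]gee0_abs.
(* The terms have both signs, so the sum in [innerV] is a genuine limit only where the series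
   converges; finiteness of [D x] gives absolute convergence almost everywhere. *)
have cS : {ae mu, forall x, [set: G] x -> S^~ x @ \oo --> limn (S^~ x)}.
  have := integrable_ae measurableT iD; apply: filterS => x /(_ I) Dx _.
  suff cF : cvgn (series (F^~ x)).
    have -> : S^~ x = EFin \o series (F^~ x).
      by apply/funext => N; rewrite SE.
    apply/cvg_ex; exists (limn (series (F^~ x)))%:E.
    by apply: cvg_EFin; [exact: nearW|exact: cF].
  apply: normed_cvg; apply: nondecreasing_is_cvgn.
    have nd : nondecreasing_seq (fun N => \sum_(0 <= k < N) `|F k x|).
      by apply/nondecreasing_seqP => N; rewrite big_nat_recr//= lerDl.
    exact: nd.
  exists (fine (D x)) => _ [N _ <-]; rewrite -lee_fin fineK//.
  exact: FD.
have bS : {ae mu, forall x N, [set: G] x -> (`|S N x| <= D x)%E}.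
  by apply: aeW => x N _; exact: SD.
have [_ _] := dominated_convergence measurableT mS (measurable_limn mS) cS iD bS.
have z N : (\int[mu]_x S N x = 0)%E.
  rewrite /S integral_sum//; last first.
    move=> k; apply: le_integrable iD => //; first exact/measurable_EFinP.
    move=> x _; rewrite [leRHS]gee0_abs//; apply: le_trans (FD k.+1 x).
    by rewrite lee_fin big_nat_recr//= lerDr sumr_ge0.
  apply: big1 => k _; apply: int_component_eq0 (PVK_ae k mf f1) _ => //.
  by have := hg k; apply: filterS => x; rewrite convG_dif.
rewrite (_ : [sequence _]_n = cst 0%E); last by apply/funext => N; exact: z.
move=> /(cvg_lim (@ereal_hausdorff R)); rewrite lim_cst; last exact: ereal_hausdorff.
exact: esym.
Qed.

End average.

Theorem theorem4p10 (R : realType) (mu : {measure set G -> \bar R})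
  (mu_prob : mu setT = 1%E)
  (mu_haar : forall (a : G) (A : set G), measurable A ->
               mu [set addG a y | y in A] = mu A) :
  (* on L^2(G, l^2), P.V.(K * f) = P f, the orthogonal projection onto
     iota(H^2(delta)) *)
  (forall f : G -> nat -> R, LpV mu 2 f ->
     {ae mu, forall x, PVexists mu f x} /\
     H2delta mu (PVK mu f) /\
     (forall g, H2delta mu g ->
        innerV mu (fun x n => f x n - PVK mu f x n) g = 0%E))
  /\
  (* on L^1(G, l^2): a.e. existence and weak type (1,1) *)
  (exists C : R, 0 < C /\
     forall f : G -> nat -> R, LpV mu 1 f ->
       {ae mu, forall x, PVexists mu f x} /\
       measV (PVK mu f) /\
       (weakL1V mu (PVK mu f) <= C%:E * LpnormV mu 1 f)%E)
  /\
  (* boundedness on L^p(G, l^2), 1 < p < oo *)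
  (forall p : R, 1 < p ->
     exists C : R, 0 < C /\
       forall f : G -> nat -> R, LpV mu p f ->
         LpV mu p (PVK mu f) /\
         (LpnormV mu p (PVK mu f) <= C%:E * LpnormV mu p f)%E).
Proof.
split; last split.
- move=> f f2; have [mf _] := f2.
  split; last by split; [exact: PVK_H2|move=> g; exact: PVK_inner].
  by apply: PVexists_ae => //; apply: LpV_L1 f2 => //; rewrite ler1n.
- by exists 2; split => // f; exact: weak_PVK.
- by move=> p p1; exact: PVK_Lp.
Qed.
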